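(* Let $\mathfrak g=\mathfrak{sl}_2$ with simple root $\alpha_1$ normalized by $(\alpha_1,\alpha_1)=2$, let $k\ge0$ be an integer and $V=V_\Lambda$ the irreducible $(2k+1)$-dimensional module of highest weight $\Lambda=k\alpha_1$ with highest weight vector $v_\Lambda$ ($n=1$, $z_1=0$, so $Z_1=1$). Let $\xi\in\mathfrak h^*$ with $\xi_1:=(\xi,\alpha_1)\notin\{1,\dots,k\}$, and let $t_{cr}=(t_1,\dots,t_k)$ be an isolated critical point of $$\Phi_H(t)=\sum_{1\le j<j'\le k}2\log(t_j-t_{j'})-2k\sum_{j=1}^k\log(t_j-1)-(\xi_1-1)\sum_{j=1}^k\log t_j.$$ Let $u=\Big(\prod_{j=1}^k\frac{1}{t_j-1}\Big)\Big|_{t=t_{cr}}\,f^kv_\Lambda\in V[0]$ (the Bethe vector $u(t_{cr},1)$). Then $$\langle\psi^\xi_u,\psi^\xi_u\rangle=\frac{\big[(\xi_1+1)(\xi_1+2)\cdots(\xi_1+k)\big]^3\,k!}{(\xi_1-1)(\xi_1-2)\cdots(\xi_1-k)\,(k+1)(k+2)\cdots(2k)}.$$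
   Context: Notation for $\mathfrak g=\mathfrak{sl}_2$: Cartan subalgebra $\mathfrak h$, simple root $\alpha_1$, $\rho=\frac12\alpha_1$, invariant form $(\cdot,\cdot)$ with $(\alpha_1,\alpha_1)=2$; Chevalley generators $e,f,h$; $\omega$ the automorphism of $U(\mathfrak g)$ with $\omega(e)=-f,\omega(f)=-e,\omega(h)=-h$; $a$ the anti-automorphism with $a(x)=-x$ for $x\in\mathfrak g$. $\gamma:U(\mathfrak g)\to\mathbb C[\mathfrak h^*]$ projection along $fU(\mathfrak g)+U(\mathfrak g)e$; $S_\mu(g_1,g_2)=\gamma(a\omega(g_1)g_2)(\mu)$. The Shapovalov form $S$ on $V$ is the symmetric bilinear form with $S(v_\Lambda,v_\Lambda)=1$ and $S(gx,y)=S(x,a\omega(g)y)$. Basis $\{F_j\}_{j\ge0}=\{f^j\}$ of $U(\mathfrak n_-)$; $(S^{-1}_\lambda)_{jk}$: entries of the inverse of $(S_\lambda(F_j,F_k))$. $X=e^{-2\pi i\alpha_1(\lambda)}$ for $\lambda\in\mathfrak h$. $A_X$ is the linear map on $U(\mathfrak n_-)$ given on $f^m$ by $A_X(f^m)=\sum_{\sigma\in S_m}\prod_{k=1}^m\frac{X^{a^\sigma_k+1}}{1-X^k}f^m$, $a_k^\sigma=\#\{j:k\le j\le m-1,\sigma(j)>\sigma(j+1)\}$, $A_X(1)=1$. For $u\in V[0]$ (under the hypothesis on $\xi_1$ the needed inverse entries are regular at $\xi-\rho$), $\psi^\xi_u(\lambda)=e^{2\pi i\xi(\lambda)}\sum_{j,k\ge0}(S^{-1}_{\xi-\rho})_{jk}A_X(F_j)\omega(F_k)u$,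 a $V[0]$-valued function of $\lambda\in\mathfrak h$. The pairing is $\langle\psi_1,\psi_2\rangle=\int_{-i\delta}^{1-i\delta}S(\psi_1(\lambda),\psi_2(-\lambda))\,dy$, with coordinate $y=\alpha_1(\lambda)$ on $\mathfrak h$ and any $\delta>0$. A critical point of $\Phi_H$ is a point with $t_j\ne t_{j'}$ ($j\neq j'$), $t_j\ne0,1$, where all $\partial\Phi_H/\partial t_j$ vanish; isolated means isolated in the critical set. *)

(* Defs.v *)
From Stdlib Require Export Reals Arith List.
Open Scope R_scope.

Record CC := mkC { Cre : R ; Cim : R }.
Definition CR (r : R) : CC := mkC r 0.
Definition C0 : CC := CR 0.
Definition C1 : CC := CR 1.
Definition Ci : CC := mkC 0 1.
Definition Cnat (n : nat) : CC := CR (INR n).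
Definition Cadd (z w : CC) : CC := mkC (Cre z + Cre w) (Cim z + Cim w).
Definition Copp (z : CC) : CC := mkC (- Cre z) (- Cim z).
Definition Csub (z w : CC) : CC := Cadd z (Copp w).
Definition Cmul (z w : CC) : CC :=
  mkC (Cre z * Cre w - Cim z * Cim w) (Cre z * Cim w + Cim z * Cre w).
Definition Cinv (z : CC) : CC :=
  let d := Cre z * Cre z + Cim z * Cim z in mkC (Cre z / d) (- Cim z / d).
Definition Cdiv (z w : CC) : CC := Cmul z (Cinv w).
Fixpoint Cpow (z : CC) (n : nat) : CC :=
  match n with O => C1 | S m => Cmul (Cpow z m) z end.
Definition Cexp (z : CC) : CC := mkC (exp (Cre z) * cos (Cim z)) (exp (Cre z) * sin (Cim z)).
Definition Cabs (z : CC) : R := sqrt (Cre z * Cre z + Cim z * Cim z).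

Fixpoint Csum (f : nat -> CC) (n : nat) : CC :=
  match n with O => C0 | S m => Cadd (Csum f m) (f m) end.
Fixpoint Cprod (f : nat -> CC) (n : nat) : CC :=
  match n with O => C1 | S m => Cmul (Cprod f m) (f m) end.

Definition is_cint (F : R -> CC) (a b : R) (I : CC) : Prop :=
  exists (p1 : Riemann_integrable (fun s => Cre (F s)) a b)
         (p2 : Riemann_integrable (fun s => Cim (F s)) a b),
    RiemannInt p1 = Cre I /\ RiemannInt p2 = Cim I.

Definition vec := nat -> CC.
Definition vadd (x y : vec) : vec := fun j => Cadd (x j) (y j).
Definition vscale (c : CC) (x : vec) : vec := fun j => Cmul c (x j).
Definition vzero : vec := fun _ => C0.
Fixpoint vsum (f : nat -> vec) (n : nat) : vec :=
  match n with O => vzero | S m => vadd (vsum f m) (f m) end.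
Definition basisv (i : nat) : vec := fun j => if Nat.eqb j i then C1 else C0.

(* ---------- The irreducible sl2-module V of highest weight k*alpha1 ----------
   dimension 2k+1, basis b_j = f^j v_Lambda (0 <= j <= 2k);
   h b_j = (2k-2j) b_j, f b_j = b_{j+1} (b_{2k+1} = 0), e b_j = j(2k-j+1) b_{j-1}. *)
Definition Vf (k : nat) (x : vec) : vec :=
  fun j => if Nat.eqb j 0 then C0 else if Nat.ltb (2*k) j then C0 else x (j - 1)%nat.
Definition Ve (k : nat) (x : vec) : vec :=
  fun j => if Nat.leb (2*k) j then C0
           else Cmul (Cmul (Cnat (j+1)) (Cnat (2*k - j))) (x (j+1)%nat).
Definition Vh (k : nat) (x : vec) : vec :=
  fun j => if Nat.ltb (2*k) j then C0
           else Cmul (Csub (Cnat (2*k)) (Cnat (2*j))) (x j).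
Definition Vomega_f (k : nat) (x : vec) : vec := vscale (Copp C1) (Ve k x).

Definition bilin (k : nat) (G : nat -> nat -> CC) (x y : vec) : CC :=
  Csum (fun j => Csum (fun l => Cmul (Cmul (x j) (G j l)) (y l)) (2*k+1)) (2*k+1).

(* G is the Gram matrix of the Shapovalov form of V:
   symmetric, S(v_Lambda, v_Lambda) = 1, and S(g x, y) = S(x, a(omega(g)) y)
   for the generators g = e, f, h (a(omega(e)) = f, a(omega(f)) = e, a(omega(h)) = h). *)
Definition is_Shapovalov_V (k : nat) (G : nat -> nat -> CC) : Prop :=
  G 0%nat 0%nat = C1 /\
  (forall x y : vec, bilin k G x y = bilin k G y x) /\
  (forall x y : vec, bilin k G (Ve k x) y = bilin k G x (Vf k y)) /\
  (forall x y : vec, bilin k G (Vf k x) y = bilin k G x (Ve k y)) /\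
  (forall x y : vec, bilin k G (Vh k x) y = bilin k G x (Vh k y)).

(* ---------- Verma module M(mu), mu1 = (mu, alpha1) = mu(h) ----------
   basis m_i = f^i v_mu, f m_i = m_{i+1}, e m_i = i (mu1 - i + 1) m_{i-1}. *)
Definition Mf (x : vec) : vec := fun j => if Nat.eqb j 0 then C0 else x (j - 1)%nat.
Definition Me (mu1 : CC) (x : vec) : vec :=
  fun j => Cmul (Cmul (Cnat (j+1)) (Csub mu1 (Cnat j))) (x (j+1)%nat).

(* S_mu(F_j, F_l) = gamma(a omega(f^j) f^l)(mu) = gamma(e^j f^l)(mu),
   i.e. the coefficient of v_mu in e^j f^l v_mu in M(mu). *)
Definition Shap_mu (mu1 : CC) (j l : nat) : CC :=
  Nat.iter j (Me mu1) (Nat.iter l Mf (basisv 0)) 0%nat.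

Fixpoint insert_all (x : nat) (l : list nat) : list (list nat) :=
  match l with
  | nil => (x :: nil) :: nil
  | y :: l' => (x :: y :: l') :: map (cons y) (insert_all x l')
  end.
(* all permutations of 1..m, as the lists [sigma(1); ...; sigma(m)] *)
Fixpoint perms (m : nat) : list (list nat) :=
  match m with
  | O => nil :: nil
  | S m' => flat_map (insert_all (S m')) (perms m')
  end.
Definition sig_at (s : list nat) (i : nat) : nat := nth (i - 1)%nat s 0%nat.
Definition a_sig (m : nat) (s : list nat) (k : nat) : nat :=
  length (filter (fun j => Nat.ltb (sig_at s (j+1)) (sig_at s j)) (seq k (m - k))).
Fixpoint Clist_sum (l : list CC) : CC :=
  match l with nil => C0 | z :: l' => Cadd z (Clist_sum l') end.
(* A_X(f^m) = coefA X m * f^m *)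
Definition coefA (X : CC) (m : nat) : CC :=
  Clist_sum (map (fun s =>
    Cprod (fun i => let kk := S i in
             Cdiv (Cpow X (a_sig m s kk + 1)) (Csub C1 (Cpow X kk))) m) (perms m)).

(* ---------- psi^xi_u ----------
   y = alpha1(lambda) in CC; xi(lambda) = xi1 * y / 2 (xi = (xi1/2) alpha1);
   X = exp(-2 pi i y).  The sum over j,l is over 0..k. *)
Definition Xof (y : CC) : CC := Cexp (Cmul (mkC 0 (-2 * PI)) y).
Definition psi (k : nat) (xi1 : CC) (Sinv : nat -> nat -> CC) (u : vec) (y : CC) : vec :=
  vscale (Cexp (Cmul (mkC 0 PI) (Cmul xi1 y)))
    (vsum (fun j => vsum (fun l =>
        vscale (Cmul (Sinv j l) (coefA (Xof y) j))
          (Nat.iter j (Vf k) (Nat.iter l (Vomega_f k) u))) (S k)) (S k)).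

(* <psi1, psi2> = int_{-i delta}^{1 - i delta} S(psi1(lambda), psi2(-lambda)) dy,
   parametrized by y = s - i delta, s in [0,1]. *)
Definition pairing_is (k : nat) (G : nat -> nat -> CC) (psi1 psi2 : CC -> vec)
  (delta : R) (I : CC) : Prop :=
  is_cint (fun s => let y := mkC s (- delta) in bilin k G (psi1 y) (psi2 (Copp y))) 0 1 I.

Definition dPhi (k : nat) (xi1 : CC) (t : nat -> CC) (j : nat) : CC :=
  Csub (Csub
    (Csum (fun j' => if Nat.eqb j' j then C0 else Cdiv (CR 2) (Csub (t j) (t j'))) k)
    (Cdiv (Cnat (2*k)) (Csub (t j) C1)))
    (Cdiv (Csub xi1 C1) (t j)).
Definition is_critical (k : nat) (xi1 : CC) (t : nat -> CC) : Prop :=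
  (forall j j', (j < k)%nat -> (j' < k)%nat -> j <> j' -> t j <> t j') /\
  (forall j, (j < k)%nat -> t j <> C0 /\ t j <> C1) /\
  (forall j, (j < k)%nat -> dPhi k xi1 t j = C0).
Definition is_isolated_critical (k : nat) (xi1 : CC) (t : nat -> CC) : Prop :=
  is_critical k xi1 t /\
  exists eps : R, eps > 0 /\
    forall t' : nat -> CC, is_critical k xi1 t' ->
      (forall j, (j < k)%nat -> Cabs (Csub (t' j) (t j)) < eps) ->
      forall j, (j < k)%nat -> t' j = t j.

(* Main.v *)
(** For [mu = xi - rho] the Shapovalov form on [U(n_-)] is diagonal, and by
    MacMahon's theorem on the major index [A_X (f^m) = z^m f^m] with
    [z = X / (1 - X)].  Hence [psi (y) = exp (i pi xi_1 y) P(z) u] for a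
    polynomial [P] with [P(0) = 1], and [y -> -y] becomes [z -> -1 - z].  On the
    line [Im y = - delta] one has [|X| < 1], so the integral of
    [P(z) P(-1 - z)] is its value [P(-1)] at [X = 0], a Chu-Vandermonde sum.

    The norm of the Bethe vector comes from [p(x) = prod (x - t_j)]: the
    critical point equations say that [p] solves a hypergeometric equation, so
    its coefficients satisfy a two-term recursion and [p(1)] is again a
    Chu-Vandermonde sum. *)

(* The answer combines three separate evaluations. Write A = (xi_1+1)...(xi_1+k), D =
   (xi_1-1)...(xi_1-k), K = (k+1)...(2k) and c = prod 1/(t_j - 1). The form on V gives S(u, u) = c^2
   k! K, the integral contributes P(-1) = A / D, and the critical point gives p(1) A = K. Since c =
   (-1)^k / p(1), the square c^2 is A^2 / K^2: two of the three powers of A come from the Bethe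
   vector, the third from the integral, and the sign disappears.

   The critical point is never solved for: it enters only through p(1). In the sum for p(1) the
   lower parameter xi_1 + 1 might a priori be a nonpositive integer, where the terms of the series
   would have zero denominators. Both sums are therefore evaluated after multiplication by the
   Pochhammer symbol of the lower parameter. *)
Require Import Defs.
From Coquelicot Require Import Rcomplements Hierarchy Continuity Derive RInt RInt_analysis AutoDerive.
From Stdlib Require Import Classical Lra Lia Psatz Permutation FunctionalExtensionality.
Open Scope R_scope.

(** * Complex arithmetic *)

Declare Scope CC_scope.
Delimit Scope CC_scope with CC.
Infix "+" := Cadd : CC_scope.
Infix "-" := Csub : CC_scope.
Infix "*" := Cmul : CC_scope.
Infix "/" := Cdiv : CC_scope.
Notation "- z" := (Copp z) : CC_scope.
Infix "^" := Cpow : CC_scope.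

Lemma CC_ext (z w : CC) : Cre z = Cre w -> Cim z = Cim w -> z = w.
Proof. destruct z, w; simpl; intros; subst; reflexivity. Qed.

Lemma sum_sqr_pos (z : CC) : z <> C0 -> 0 < Cre z * Cre z + Cim z * Cim z.
Proof.
  intros Hz.
  destruct (Req_dec (Cre z) 0) as [Ha|Ha]; [|nra].
  destruct (Req_dec (Cim z) 0) as [Hb|Hb]; [|nra].
  exfalso; apply Hz, CC_ext; assumption.
Qed.

Lemma CC_field_theory : field_theory C0 C1 Cadd Cmul Csub Copp Cdiv Cinv eq.
Proof.
  constructor; [constructor| | |]; intros; try (apply CC_ext; simpl; ring).
  - intros H; apply (f_equal Cre) in H; simpl in H; lra.
  - pose proof (sum_sqr_pos p H).
    apply CC_ext; simpl; field; lra.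
Qed.
Add Field CC_field : CC_field_theory.

Lemma Cmul_integral (z w : CC) : (z * w)%CC = C0 -> z = C0 \/ w = C0.
Proof.
  intros H; destruct (Classical_Prop.classic (z = C0)) as [Hz|Hz]; [now left|right].
  transitivity (Cinv z * (z * w))%CC; [field; assumption|rewrite H; ring].
Qed.

Lemma Cmul_neq_0 (z w : CC) : z <> C0 -> w <> C0 -> (z * w)%CC <> C0.
Proof. intros Hz Hw H; destruct (Cmul_integral z w H); auto. Qed.

Lemma Csub_neq_0 (z w : CC) : z <> w -> (z - w)%CC <> C0.
Proof.
  intros H E; apply H; transitivity ((z - w) + w)%CC; [ring|rewrite E; ring].
Qed.

Lemma Cmul_cancel_l (a z w : CC) : a <> C0 -> (a * z = a * w)%CC -> z = w.
Proof.
  intros Ha H; transitivity (Cinv a * (a * z))%CC;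
    [field; assumption|rewrite H; field; assumption].
Qed.

Lemma Cnat_0 : Cnat 0 = C0.
Proof. reflexivity. Qed.

Lemma Cnat_S (n : nat) : Cnat (S n) = (Cnat n + C1)%CC.
Proof. apply CC_ext; unfold Cnat; [rewrite S_INR|]; simpl; ring. Qed.

Lemma Cnat_add (m n : nat) : Cnat (m + n) = (Cnat m + Cnat n)%CC.
Proof. apply CC_ext; unfold Cnat; [rewrite plus_INR|]; simpl; ring. Qed.

Lemma Cnat_mul (m n : nat) : Cnat (m * n) = (Cnat m * Cnat n)%CC.
Proof. apply CC_ext; unfold Cnat; [rewrite mult_INR|]; simpl; ring. Qed.

Lemma Cnat_sub (m n : nat) : (n <= m)%nat -> Cnat (m - n) = (Cnat m - Cnat n)%CC.
Proof. intros; apply CC_ext; unfold Cnat; [rewrite minus_INR by lia|]; simpl; ring. Qed.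

Lemma Cnat_inj (m n : nat) : Cnat m = Cnat n -> m = n.
Proof. intros H; apply INR_eq; exact (f_equal Cre H). Qed.

Lemma Cnat_S_neq_0 (n : nat) : Cnat (S n) <> C0.
Proof. intros H; apply (Cnat_inj (S n) 0) in H; discriminate. Qed.

Lemma CR_2 : CR 2 = (C1 + C1)%CC.
Proof. apply CC_ext; simpl; ring. Qed.

Lemma Cpow_add (z : CC) (m n : nat) : (z ^ (m + n) = z ^ m * z ^ n)%CC.
Proof.
  induction m as [|m IH]; simpl; [ring|rewrite IH; ring].
Qed.

Lemma Cpow_neq_0 (z : CC) (n : nat) : z <> C0 -> (z ^ n)%CC <> C0.
Proof.
  intros Hz; induction n; simpl.
  - apply (F_1_neq_0 CC_field_theory).
  - now apply Cmul_neq_0.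
Qed.

Lemma Cpow_Cinv (z : CC) (n : nat) : z <> C0 -> (Cinv z ^ n)%CC = Cinv (z ^ n)%CC.
Proof.
  intros Hz; induction n as [|n IH]; simpl.
  - field; apply (F_1_neq_0 CC_field_theory).
  - rewrite IH; field; split; [assumption|now apply Cpow_neq_0].
Qed.

Lemma Csum_ext (f g : nat -> CC) (n : nat) :
  (forall i, (i < n)%nat -> f i = g i) -> Csum f n = Csum g n.
Proof. induction n; simpl; intros H; [reflexivity|rewrite IHn, H by auto; auto]. Qed.

Lemma Cprod_ext (f g : nat -> CC) (n : nat) :
  (forall i, (i < n)%nat -> f i = g i) -> Cprod f n = Cprod g n.
Proof. induction n; simpl; intros H; [reflexivity|rewrite IHn, H by auto; auto]. Qed.

Lemma Csum_0 (f : nat -> CC) (n : nat) :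
  (forall i, (i < n)%nat -> f i = C0) -> Csum f n = C0.
Proof. induction n; simpl; intros H; [reflexivity|rewrite IHn, H by auto; ring]. Qed.

Lemma Csum_add (f g : nat -> CC) (n : nat) :
  Csum (fun i => f i + g i)%CC n = (Csum f n + Csum g n)%CC.
Proof. induction n; simpl; [ring|rewrite IHn; ring]. Qed.

Lemma Csum_mul_l (c : CC) (f : nat -> CC) (n : nat) :
  Csum (fun i => c * f i)%CC n = (c * Csum f n)%CC.
Proof. induction n; simpl; [ring|rewrite IHn; ring]. Qed.

Lemma Csum_first (f : nat -> CC) (n : nat) :
  Csum f (S n) = (f 0%nat + Csum (fun i => f (S i)) n)%CC.
Proof.
  induction n; [simpl; ring|].
  change (Csum f (S (S n))) with (Csum f (S n) + f (S n))%CC.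
  rewrite IHn; simpl; ring.
Qed.

Lemma Csum_single (f : nat -> CC) (n m : nat) :
  (m < n)%nat -> (forall i, (i < n)%nat -> i <> m -> f i = C0) -> Csum f n = f m.
Proof.
  induction n; simpl; intros Hm H; [lia|].
  destruct (Nat.eq_dec m n) as [->|Hne].
  - rewrite Csum_0 by (intros; apply H; lia); ring.
  - rewrite IHn, (H n) by (auto; lia); ring.
Qed.

Lemma Csum_rev (f : nat -> CC) (n : nat) :
  Csum (fun i => f (n - S i)%nat) n = Csum f n.
Proof.
  induction n; [reflexivity|].
  rewrite Csum_first; simpl.
  rewrite Nat.sub_0_r, IHn; ring.
Qed.

Lemma Cprod_first (f : nat -> CC) (n : nat) :
  Cprod f (S n) = (f 0%nat * Cprod (fun i => f (S i)) n)%CC.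
Proof.
  induction n; [simpl; ring|].
  change (Cprod f (S (S n))) with (Cprod f (S n) * f (S n))%CC.
  rewrite IHn; simpl; ring.
Qed.

Lemma Cprod_mul (f g : nat -> CC) (n : nat) :
  Cprod (fun i => f i * g i)%CC n = (Cprod f n * Cprod g n)%CC.
Proof. induction n; simpl; [ring|rewrite IHn; ring]. Qed.

Lemma Cprod_neq_0 (f : nat -> CC) (n : nat) :
  (forall i, (i < n)%nat -> f i <> C0) -> Cprod f n <> C0.
Proof.
  induction n; simpl; intros H; [apply (F_1_neq_0 CC_field_theory)|].
  apply Cmul_neq_0; auto.
Qed.

Lemma Cprod_Cinv (f : nat -> CC) (n : nat) :
  (forall i, (i < n)%nat -> f i <> C0) -> Cprod (fun i => Cinv (f i)) n = Cinv (Cprod f n).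
Proof.
  induction n; simpl; intros H; [field; apply (F_1_neq_0 CC_field_theory)|].
  rewrite IHn by auto; field; split; [|apply Cprod_neq_0]; auto.
Qed.

Lemma Cprod_rev (f : nat -> CC) (n : nat) :
  Cprod (fun i => f (n - S i)%nat) n = Cprod f n.
Proof.
  induction n; [reflexivity|].
  rewrite Cprod_first; simpl.
  rewrite Nat.sub_0_r, IHn; ring.
Qed.

Lemma Cprod_neg_one (n : nat) : (Cprod (fun _ => - C1) n * Cprod (fun _ => - C1) n)%CC = C1.
Proof.
  induction n; simpl; [ring|].
  transitivity (Cprod (fun _ => - C1) n * Cprod (fun _ => - C1) n)%CC; [ring|assumption].
Qed.

Lemma Cnat_fact (n : nat) : Cnat (fact n) = Cprod (fun i => Cnat (S i)) n.
Proof.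
  induction n; [reflexivity|].
  change (fact (S n)) with (S n * fact n)%nat.
  rewrite Cnat_mul, IHn; simpl Cprod; ring.
Qed.

(** * The major index *)

Fixpoint descents (l : list nat) : nat :=
  match l with
  | y :: (z :: _) as l' => (if Nat.ltb z y then 1 else 0) + descents l'
  | _ => 0
  end%nat.

(* The major index when the first letter of [l] sits at position [i]. *)
Fixpoint major (i : nat) (l : list nat) : nat :=
  match l with
  | y :: (z :: _) as l' => (if Nat.ltb z y then i else 0) + major (S i) l'
  | _ => 0
  end%nat.

(** Moving the word one place to the right raises the position of each descent by one. *)
Lemma major_S (i : nat) (l : list nat) : major (S i) l = (major i l + descents l)%nat.
Proof.
  revert i; induction l as [|y [|z l] IH]; intros i; try reflexivity.
  change (((if Nat.ltb z y then S i else 0) + major (S (S i)) (z :: l) =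
    (if Nat.ltb z y then i else 0) + major (S i) (z :: l) +
    ((if Nat.ltb z y then 1 else 0) + descents (z :: l)))%nat).
  rewrite (IH (S i)); destruct (Nat.ltb z y); lia.
Qed.

Lemma Clist_sum_app (l l' : list CC) :
  Clist_sum (l ++ l') = (Clist_sum l + Clist_sum l')%CC.
Proof. induction l; simpl; [ring|rewrite IHl; ring]. Qed.

Lemma Clist_sum_map_mul {A : Type} (c : CC) (f : A -> CC) (l : list A) :
  Clist_sum (map (fun a => c * f a)%CC l) = (c * Clist_sum (map f l))%CC.
Proof. induction l; simpl; [ring|rewrite IHl; ring]. Qed.

(** These insertions keep the first letter, so the induction on the tail still knows which letter
    comes before it. *)
Definition insert_later (x : nat) (l : list nat) : list (list nat) :=
  match l with nil => nil | y :: l' => map (cons y) (insert_all x l') end.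

Lemma insert_all_later (x y : nat) (l : list nat) :
  insert_all x (y :: l) = (x :: y :: l) :: insert_later x (y :: l).
Proof. reflexivity. Qed.

(* Inserting the maximum at the end, in a descent, or in an ascent of [l]
   raises the major index by pairwise distinct amounts: 0 to [d], and
   [i + d + 1] to [i + n - 1]; the sum of powers is telescoped by [1 - X]. *)
Lemma insert_later_major (X : CC) (x i : nat) (y : nat) (l : list nat) :
  (forall z, In z (y :: l) -> (z < x)%nat) ->
  ((C1 - X) * Clist_sum (map (fun s => X ^ major i s) (insert_later x (y :: l))) =
   X ^ major i (y :: l) * (C1 - X ^ S (descents (y :: l))
     + X ^ S (i + descents (y :: l)) - X ^ (i + S (length l))))%CC.
Proof.
  revert i y; induction l as [|z l IH]; intros i y Hlt.
  - simpl. rewrite (proj2 (Nat.ltb_ge x y)) by (apply Nat.lt_le_incl, Hlt; now left).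
    rewrite !Nat.add_0_r, Nat.add_1_r; simpl; ring.
  - set (D := if Nat.ltb z y then i else 0%nat).
    change (insert_later x (y :: z :: l)) with
      (map (cons y) (insert_all x (z :: l))).
    rewrite insert_all_later; cbn [map]; rewrite map_map.
    assert (E : map (fun s => X ^ major i (y :: s))%CC (insert_later x (z :: l)) =
      map (fun s => X ^ D * X ^ major (S i) s)%CC (insert_later x (z :: l))).
    { apply map_ext_in; intros s Hs; unfold insert_later in Hs.
      apply in_map_iff in Hs; destruct Hs as [s' [<- _]].
      rewrite <- Cpow_add; reflexivity. }
    rewrite E.
    change (Clist_sum (?a :: ?b)) with (a + Clist_sum b)%CC.
    rewrite Clist_sum_map_mul.
    assert (Hz : forall w, In w (z :: l) -> (w < x)%nat)
      by (intros w Hw; apply Hlt; now right).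
    specialize (IH (S i) z Hz).
    (* The maximum [x] between [y] and [z] removes a possible descent at [i], creates one at [S i],
       and moves [z :: l] one place to the right. *)
    assert (Ef : major i (y :: x :: z :: l) =
      (S i + (major (S i) (z :: l) + descents (z :: l)))%nat).
    { rewrite <- major_S.
      change (major i (y :: x :: z :: l)) with
        ((if Nat.ltb x y then i else 0) +
         ((if Nat.ltb z x then S i else 0) + major (S (S i)) (z :: l)))%nat.
      rewrite (proj2 (Nat.ltb_ge x y)) by (apply Nat.lt_le_incl, Hlt; now left).
      rewrite (proj2 (Nat.ltb_lt z x)) by (apply Hlt; right; now left).
      reflexivity. }
    rewrite Ef.
    change (major i (y :: z :: l)) with (D + major (S i) (z :: l))%nat.
    change (descents (y :: z :: l)) with
      ((if Nat.ltb z y then 1 else 0) + descents (z :: l))%nat.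
    set (S0 := Clist_sum _) in *.
    transitivity ((C1 - X) * X ^ (S i + (major (S i) (z :: l) + descents (z :: l)))
      + X ^ D * ((C1 - X) * S0))%CC; [ring|].
    rewrite IH; unfold D; clear.
    destruct (Nat.ltb z y); simpl length;
      repeat rewrite ?Nat.add_succ_r, ?Nat.add_succ_l, ?Nat.add_0_l, ?Nat.add_0_r;
      simpl Cpow; rewrite !Cpow_add; ring.
Qed.

(** For a word starting at position 1, the later insertions raise the major index by every amount
    from 0 to [length l] except d + 1, where d is the number of descents. Insertion at the front
    supplies exactly d + 1, and the full geometric sum remains. *)
Lemma insert_all_major (X : CC) (x : nat) (l : list nat) :
  (forall z, In z l -> (z < x)%nat) ->
  ((C1 - X) * Clist_sum (map (fun s => X ^ major 1 s) (insert_all x l)) =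
   X ^ major 1 l * (C1 - X ^ S (length l)))%CC.
Proof.
  destruct l as [|y l]; intros Hlt; [simpl; ring|].
  rewrite insert_all_later; cbn [map].
  change (Clist_sum (?a :: ?b)) with (a + Clist_sum b)%CC.
  assert (Ef : major 1 (x :: y :: l) = (1 + (major 1 (y :: l) + descents (y :: l)))%nat).
  { rewrite <- major_S.
    change (major 1 (x :: y :: l)) with
      ((if Nat.ltb y x then 1 else 0) + major 2 (y :: l))%nat.
    rewrite (proj2 (Nat.ltb_lt y x)) by (apply Hlt; now left); reflexivity. }
  rewrite Ef.
  pose proof (insert_later_major X x 1 y l Hlt) as H.
  set (S0 := Clist_sum _) in *.
  transitivity ((C1 - X) * X ^ (1 + (major 1 (y :: l) + descents (y :: l)))
    + (C1 - X) * S0)%CC; [ring|].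
  rewrite H; simpl length; simpl Nat.add; simpl Cpow; rewrite Cpow_add; ring.
Qed.

Lemma in_insert_all (x : nat) (l s : list nat) :
  In s (insert_all x l) -> Permutation s (x :: l).
Proof.
  revert s; induction l as [|y l IH]; simpl; intros s H.
  - destruct H as [<-|[]]; reflexivity.
  - destruct H as [<-|H]; [reflexivity|].
    apply in_map_iff in H; destruct H as [s' [<- Hs']].
    rewrite (IH s' Hs'); apply perm_swap.
Qed.

Lemma in_perms (m : nat) (s : list nat) :
  In s (perms m) -> length s = m /\ forall z, In z s -> (z <= m)%nat.
Proof.
  revert s; induction m as [|m IH]; simpl; intros s H.
  - destruct H as [<-|[]]; split; [reflexivity|intros z []].
  - apply in_flat_map in H; destruct H as [l [Hl Hs]].
    destruct (IH l Hl) as [Hlen Hle].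
    pose proof (in_insert_all _ _ _ Hs) as HP; split.
    + rewrite (Permutation_length HP); simpl; lia.
    + intros z Hz; apply (Permutation_in _ HP) in Hz.
      destruct Hz as [<-|Hz]; [lia|specialize (Hle z Hz); lia].
Qed.

(** Inserting the new maximum in all places multiplies the generating function by the X-integer 1 +
    X + ... + X^(m-1); clearing denominators keeps X = 1 allowed. *)
Lemma perms_major (X : CC) (m : nat) :
  (Clist_sum (map (fun s => X ^ major 1 s) (perms m)) * (C1 - X) ^ m =
   Cprod (fun i => C1 - X ^ S i) m)%CC.
Proof.
  induction m as [|m IH]; [simpl; ring|].
  assert (H : forall L, (forall l, In l L -> In l (perms m)) ->
    ((C1 - X) * Clist_sum (map (fun s => X ^ major 1 s) (flat_map (insert_all (S m)) L)) =
     (C1 - X ^ S m) * Clist_sum (map (fun s => X ^ major 1 s) L))%CC).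
  { induction L as [|l L IHL]; intros HL; [simpl; ring|].
    cbn [flat_map]; rewrite map_app, Clist_sum_app.
    destruct (in_perms m l (HL l (or_introl eq_refl))) as [Hlen Hle].
    assert (Hlt : forall z, In z l -> (z < S m)%nat)
      by (intros z Hz; specialize (Hle z Hz); lia).
    pose proof (insert_all_major X (S m) l Hlt) as H1.
    specialize (IHL (fun l' Hl' => HL l' (or_intror Hl'))).
    rewrite Hlen in H1.
    set (A := Clist_sum (map _ (insert_all (S m) l))) in *.
    set (B := Clist_sum (map _ (flat_map _ L))) in *.
    transitivity ((C1 - X) * A + (C1 - X) * B)%CC; [ring|].
    rewrite H1, IHL; simpl; ring. }
  specialize (H (perms m) (fun l h => h)).
  change (perms (S m)) with (flat_map (insert_all (S m)) (perms m)).
  set (A := Clist_sum (map _ (flat_map _ _))) in *.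
  transitivity (((C1 - X) * A) * (C1 - X) ^ m)%CC; [simpl; ring|].
  rewrite H.
  change (Cprod (fun i => C1 - X ^ S i)%CC (S m)) with
    (Cprod (fun i => C1 - X ^ S i) m * (C1 - X ^ S m))%CC.
  rewrite <- IH; ring.
Qed.

(** A letter in front shifts all positions by one. Positions start at 1: by truncated subtraction
    [sig_at s 0] reads the same letter as [sig_at s 1], hence the bound on [k]. *)
Lemma a_sig_cons (m k y : nat) (s : list nat) :
  (1 <= k)%nat -> a_sig (S m) (y :: s) (S k) = a_sig m s k.
Proof.
  intros Hk; unfold a_sig; simpl Nat.sub.
  rewrite <- (seq_shift (m - k) k).
  assert (H : forall n j0, (1 <= j0)%nat ->
    length (filter (fun j => Nat.ltb (sig_at (y :: s) (j + 1)) (sig_at (y :: s) j))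
      (map S (seq j0 n))) =
    length (filter (fun j => Nat.ltb (sig_at s (j + 1)) (sig_at s j)) (seq j0 n))).
  { induction n as [|n IH]; intros j0 Hj0; [reflexivity|].
    assert (E1 : sig_at (y :: s) (S j0 + 1) = sig_at s (j0 + 1)).
    { unfold sig_at; replace (S j0 + 1 - 1)%nat with (S j0) by lia.
      replace (j0 + 1 - 1)%nat with j0 by lia; reflexivity. }
    assert (E2 : sig_at (y :: s) (S j0) = sig_at s j0).
    { unfold sig_at; replace (S j0 - 1)%nat with (S (j0 - 1)) by lia; reflexivity. }
    cbn [seq map filter]; rewrite E1, E2.
    specialize (IH (S j0) ltac:(lia)).
    destruct (Nat.ltb _ _); cbn [length]; rewrite IH; reflexivity. }
  apply H; assumption.
Qed.

Lemma a_sig_1 (s : list nat) : a_sig (length s) s 1 = descents s.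
Proof.
  induction s as [|y [|z s] IH]; try reflexivity.
  change (descents (y :: z :: s)) with
    ((if Nat.ltb z y then 1 else 0) + descents (z :: s))%nat.
  rewrite <- IH, <- (a_sig_cons (length (z :: s)) 1 y (z :: s)) by lia.
  unfold a_sig; simpl length; simpl Nat.sub.
  rewrite ?Nat.sub_0_r; cbn [seq filter].
  change (1 + 1)%nat with 2%nat.
  change (Nat.ltb (sig_at (y :: z :: s) 2) (sig_at (y :: z :: s) 1))
    with (Nat.ltb z y).
  destruct (Nat.ltb z y); reflexivity.
Qed.

(** A descent at position p is counted once in each of a_1, ..., a_p, so these numbers add up to the
    major index. *)
Lemma Cprod_pow_a_sig (X : CC) (s : list nat) :
  Cprod (fun i => X ^ a_sig (length s) s (S i))%CC (length s) = (X ^ major 1 s)%CC.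
Proof.
  induction s as [|y s IH]; [reflexivity|].
  cbn [length]; rewrite Cprod_first.
  change (S (length s)) with (length (y :: s)) at 1.
  rewrite a_sig_1.
  rewrite (Cprod_ext _ (fun i => X ^ a_sig (length s) s (S i))%CC)
    by (intros; rewrite a_sig_cons by lia; reflexivity).
  rewrite IH, <- Cpow_add; f_equal.
  destruct s as [|z s]; [reflexivity|].
  change (major 1 (y :: z :: s)) with
    ((if Nat.ltb z y then 1 else 0) + major 2 (z :: s))%nat.
  change (descents (y :: z :: s)) with
    ((if Nat.ltb z y then 1 else 0) + descents (z :: s))%nat.
  rewrite (major_S 1); lia.
Qed.

Lemma Cprod_const (c : CC) (n : nat) : Cprod (fun _ => c) n = (c ^ n)%CC.
Proof. induction n; simpl; [reflexivity|rewrite IHn; ring]. Qed.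

(* MacMahon: the major index generates the X-factorial. *)
Lemma coefA_eq (X : CC) (m : nat) :
  (forall i, (X ^ S i)%CC <> C1) -> coefA X m = ((X / (C1 - X)) ^ m)%CC.
Proof.
  intros HX.
  assert (Hf : forall i, (C1 - X ^ S i)%CC <> C0)
    by (intros i; apply Csub_neq_0, not_eq_sym, HX).
  assert (H1 : (C1 - X)%CC <> C0).
  { specialize (Hf 0%nat); simpl in Hf; intros E; apply Hf; rewrite <- E; ring. }
  set (Q := Cprod (fun i => C1 - X ^ S i)%CC m).
  assert (HQ : Q <> C0) by (apply Cprod_neq_0; auto).
  assert (E : coefA X m =
    (X ^ m * Cinv Q * Clist_sum (map (fun s => X ^ major 1 s) (perms m)))%CC).
  { unfold coefA; rewrite <- Clist_sum_map_mul; f_equal.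
    apply map_ext_in; intros s Hs.
    destruct (in_perms m s Hs) as [Hlen _].
    unfold Q; rewrite <- (Cprod_pow_a_sig X s), <- Cprod_Cinv, <- Cprod_const, Hlen by auto.
    rewrite <- !Cprod_mul; apply Cprod_ext; intros i _.
    rewrite Cpow_add; unfold Cdiv; simpl; ring. }
  rewrite E; pose proof (perms_major X m) as HP; fold Q in HP.
  set (W := Clist_sum _) in *.
  assert (HW : ((C1 - X) ^ m <> C0)%CC) by (apply Cpow_neq_0; assumption).
  assert (Ez : ((X / (C1 - X)) ^ m * (C1 - X) ^ m = X ^ m)%CC).
  { clear - H1; induction m as [|m IH]; simpl; [ring|].
    rewrite <- IH; field; assumption. }
  apply (Cmul_cancel_l ((C1 - X) ^ m)%CC); [assumption|].
  transitivity (X ^ m * Cinv Q * (W * (C1 - X) ^ m))%CC; [ring|].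
  rewrite HP.
  transitivity (X ^ m)%CC; [field; assumption|rewrite <- Ez; ring].
Qed.

(** * The Chu-Vandermonde sum *)

Fixpoint binom (n j : nat) : nat :=
  match n, j with
  | _, O => 1
  | O, S _ => 0
  | S n', S j' => binom n' j' + binom n' (S j')
  end.

Lemma binom_gt (n j : nat) : (n < j)%nat -> binom n j = 0%nat.
Proof.
  revert j; induction n; intros [|j] H; simpl; try lia.
  rewrite !IHn by lia; reflexivity.
Qed.

Lemma binom_succ_mul (n j : nat) : (S j * binom n (S j) = (n - j) * binom n j)%nat.
Proof.
  revert j; induction n as [|n IH]; intros j; [simpl; lia|].
  destruct j as [|j].
  - specialize (IH 0%nat); simpl in *; destruct n; simpl in *; lia.
  - change (binom (S n) (S (S j))) with (binom n (S j) + binom n (S (S j)))%nat.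
    change (binom (S n) (S j)) with (binom n j + binom n (S j))%nat.
    pose proof (IH j) as H1; pose proof (IH (S j)) as H2.
    destruct (Nat.le_gt_cases n j) as [Hn|Hn].
    + rewrite !(binom_gt n) by lia.
      replace (S n - S j)%nat with 0%nat by lia; lia.
    + replace (S n - S j)%nat with (S (n - S j)) by lia.
      replace (n - j)%nat with (S (n - S j)) in H1 by lia.
      nia.
Qed.

Definition poch (c : CC) (n : nat) : CC := Cprod (fun i => c + Cnat i)%CC n.
Definition falling (b : CC) (n : nat) : CC := Cprod (fun i => b - Cnat i)%CC n.

Lemma poch_first (c : CC) (n : nat) : poch c (S n) = (c * poch (c + C1) n)%CC.
Proof.
  unfold poch; rewrite Cprod_first; f_equal; [rewrite Cnat_0; ring|].
  apply Cprod_ext; intros; rewrite Cnat_S; ring.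
Qed.

Lemma poch_last (c : CC) (n : nat) : poch c (S n) = (poch c n * (c + Cnat n))%CC.
Proof. reflexivity. Qed.

Lemma poch_add (c : CC) (m n : nat) : poch c (m + n) = (poch c m * poch (c + Cnat m) n)%CC.
Proof.
  induction n as [|n IH].
  - rewrite Nat.add_0_r; unfold poch; simpl; ring.
  - rewrite Nat.add_succ_r, !poch_last, IH, Cnat_add; ring.
Qed.

(** Pascal's rule splits the sum for k + 1 in two. The two terms with the same [binom k j] share all
    factors but B - j and c + j, which add up to B + c; what is left is the sum for k with c + 1 in
    place of c. *)
Lemma vandermonde (B c : CC) (k : nat) :
  Csum (fun j => Cnat (binom k j) * falling B j * poch (c + Cnat j) (k - j))%CC (S k)
  = poch (B + c)%CC k.
Proof.
  revert c; induction k as [|k IH]; intros c.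
  - unfold falling, poch; simpl; rewrite Cnat_S, Cnat_0; ring.
  - rewrite poch_first; replace (B + c + C1)%CC with (B + (c + C1))%CC by ring.
    rewrite <- (IH (c + C1)%CC), <- Csum_mul_l.
    rewrite Csum_first.
    rewrite (Csum_ext (fun i => Cnat (binom (S k) (S i)) * _ * _)%CC
      (fun i => Cnat (binom k i) * falling B (S i) * poch (c + Cnat (S i)) (k - i)
        + Cnat (binom k (S i)) * falling B (S i) * poch (c + Cnat (S i)) (k - i))%CC).
    2:{ intros i _; change (binom (S k) (S i)) with (binom k i + binom k (S i))%nat.
        rewrite Cnat_add; simpl Nat.sub; ring. }
    rewrite Csum_add.
    set (g := fun j => (Cnat (binom k j) * falling B j * poch (c + Cnat j) (S k - j))%CC).
    (* The second half of Pascal's rule, reindexed to start at j = 0; its top term vanishes because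
       [binom k (S k)] is 0. *)
    assert (E : (Cnat (binom (S k) 0) * falling B 0 * poch (c + Cnat 0) (S k - 0)
        + Csum (fun i => Cnat (binom k (S i)) * falling B (S i) *
              poch (c + Cnat (S i)) (k - i)) (S k))%CC = Csum g (S k)).
    { transitivity (Csum g (S (S k))).
      - rewrite (Csum_first g (S k)); unfold g; destruct k; reflexivity.
      - change (Csum g (S (S k))) with (Csum g (S k) + g (S k))%CC.
        unfold g at 2; rewrite (binom_gt k (S k)) by lia; rewrite Cnat_0; ring. }
    set (a := Cmul (Cmul (Cnat (binom (S k) 0)) _) _) in *.
    set (b := Csum _ (S k)) at 1.
    set (d := Csum (fun i => Cnat (binom k (S i)) * _ * _)%CC (S k)) in *.
    transitivity (b + (a + d))%CC; [ring|].
    rewrite E; unfold b; rewrite <- Csum_add; apply Csum_ext; intros j Hj.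
    unfold g; replace (S k - j)%nat with (S (k - j)) by lia.
    rewrite poch_first.
    change (falling B (S j)) with (falling B j * (B - Cnat j))%CC.
    rewrite Cnat_S.
    replace (c + Cnat j + C1)%CC with (c + C1 + Cnat j)%CC by ring.
    replace (c + (Cnat j + C1))%CC with (c + C1 + Cnat j)%CC by ring.
    ring.
Qed.

(* The terms of 2F1(-k, -B; c; 1) are given by their ratios, without divisions,
   so that c may be a nonpositive integer. *)
Lemma chu_vandermonde (k : nat) (c B : CC) (r : nat -> CC) :
  r 0%nat = C1 ->
  (forall j, (j < k)%nat ->
     r (S j) * (Cnat (S j) * (c + Cnat j)) = r j * (Cnat (k - j) * (B - Cnat j)))%CC ->
  (Csum r (S k) * poch c k)%CC = poch (B + c)%CC k.
Proof.
  intros H0 Hr.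
  assert (H : forall j, (j <= k)%nat ->
    (r j * poch c j = Cnat (binom k j) * falling B j)%CC).
  { induction j as [|j IH]; intros Hj.
    - rewrite H0; unfold poch, falling; destruct k; simpl; rewrite Cnat_S, Cnat_0; ring.
    - apply (Cmul_cancel_l (Cnat (S j))); [apply Cnat_S_neq_0|].
      rewrite poch_last.
      transitivity (r (S j) * (Cnat (S j) * (c + Cnat j)) * poch c j)%CC; [ring|].
      rewrite Hr by lia.
      transitivity (Cnat (k - j) * (B - Cnat j) * (r j * poch c j))%CC; [ring|].
      rewrite IH by lia.
      change (falling B (S j)) with (falling B j * (B - Cnat j))%CC.
      transitivity (Cnat ((k - j) * binom k j) * falling B j * (B - Cnat j))%CC;
        [rewrite Cnat_mul; ring|].
      rewrite <- binom_succ_mul, Cnat_mul; ring. }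
  rewrite <- vandermonde.
  transitivity (poch c k * Csum r (S k))%CC; [ring|].
  rewrite <- Csum_mul_l; apply Csum_ext; intros j Hj.
  rewrite <- H by lia.
  replace k with (j + (k - j))%nat at 1 by lia.
  rewrite poch_add; ring.
Qed.

(** * Critical points *)

Definition peval (n : nat) (f : nat -> CC) (x : CC) : CC := Csum (fun m => f m * x ^ m)%CC n.

Lemma peval_first (n : nat) (f : nat -> CC) (x : CC) :
  peval (S n) f x = (f 0%nat + x * peval n (fun m => f (S m)) x)%CC.
Proof.
  unfold peval; rewrite Csum_first, <- Csum_mul_l.
  f_equal; [simpl; ring|apply Csum_ext; intros; simpl; ring].
Qed.

Lemma peval_ext (n : nat) (f g : nat -> CC) (x : CC) :
  (forall m, (m < n)%nat -> f m = g m) -> peval n f x = peval n g x.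
Proof. intros H; apply Csum_ext; intros; rewrite H by assumption; reflexivity. Qed.

Lemma peval_shift (n : nat) (g : nat -> CC) (x : CC) :
  g 0%nat = C0 -> g n = C0 -> (peval n g x = x * peval n (fun m => g (S m)) x)%CC.
Proof.
  intros H0 Hn; transitivity (peval (S n) g x).
  - unfold peval; simpl; rewrite Hn; ring.
  - rewrite peval_first, H0; ring.
Qed.

Lemma peval_add (n : nat) (f g : nat -> CC) (x : CC) :
  peval n (fun m => f m + g m)%CC x = (peval n f x + peval n g x)%CC.
Proof. unfold peval; rewrite <- Csum_add; apply Csum_ext; intros; ring. Qed.

Lemma peval_scale (n : nat) (c : CC) (f : nat -> CC) (x : CC) :
  peval n (fun m => c * f m)%CC x = (c * peval n f x)%CC.
Proof. unfold peval; rewrite <- Csum_mul_l; apply Csum_ext; intros; ring. Qed.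

(** Synthetic division by x - a. The second clause says that a zero quotient leaves only a constant,
    which is what the induction on the number of roots needs. *)
Lemma peval_divide (n : nat) (f : nat -> CC) (a : CC) :
  exists g : nat -> CC,
    (forall x, (peval (S n) f x - peval (S n) f a = (x - a) * peval n g x)%CC) /\
    ((forall m, (m < n)%nat -> g m = C0) -> forall m, (1 <= m <= n)%nat -> f m = C0).
Proof.
  revert f; induction n as [|n IH]; intros f.
  - exists f; split; [intros x; unfold peval; simpl; ring|intros; lia].
  - destruct (IH (fun m => f (S m))) as [g [Hg Hg0]].
    set (v := peval (S n) (fun m => f (S m)) a) in *.
    exists (fun m => match m with O => v | S m' => g m' end); split.
    + intros x; rewrite (peval_first n (fun m => match m with O => v | S m' => g m' end)).
      rewrite !(peval_first (S n)); fold v.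
      transitivity (x * (peval (S n) (fun m => f (S m)) x - v) + (x - a) * v)%CC; [ring|].
      rewrite Hg; change (fun m => g m) with g; ring.
    + intros H0.
      assert (Hf : forall m, (1 <= m <= n)%nat -> f (S m) = C0).
      { apply Hg0; intros m Hm; exact (H0 (S m) ltac:(lia)). }
      intros [|[|m]] Hm; [lia| |apply Hf; lia].
      rewrite <- (H0 0%nat ltac:(lia)); unfold v; rewrite peval_first.
      unfold peval; rewrite Csum_0; [ring|].
      intros i Hi; rewrite Hf by lia; ring.
Qed.

Lemma peval_roots (n : nat) (f : nat -> CC) (x : nat -> CC) :
  (forall i j, (i < n)%nat -> (j < n)%nat -> i <> j -> x i <> x j) ->
  (forall i, (i < n)%nat -> peval n f (x i) = C0) ->
  forall m, (m < n)%nat -> f m = C0.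
Proof.
  revert f; induction n as [|n IH]; intros f Hx Hf; [intros; lia|].
  destruct (peval_divide n f (x n)) as [g [Hg Hg0]].
  assert (H : forall m, (1 <= m <= n)%nat -> f m = C0).
  { apply Hg0, IH; [intros; apply Hx; lia|].
    intros i Hi; specialize (Hg (x i)); rewrite !Hf in Hg by lia.
    destruct (Cmul_integral (x i - x n)%CC (peval n g (x i))) as [E|E]; [|exfalso|assumption].
    - rewrite <- Hg; ring.
    - revert E; apply Csub_neq_0, Hx; lia. }
  intros [|m] Hm; [|apply H; lia].
  rewrite <- (Hf n ltac:(lia)), peval_first.
  unfold peval; rewrite Csum_0; [ring|].
  intros i Hi; rewrite H by lia; ring.
Qed.

Definition mul_linear (a : CC) (f : nat -> CC) : nat -> CC :=
  fun m => ((match m with O => C0 | S m' => f m' end) - a * f m)%CC.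

Fixpoint roots_coef (l : list CC) : nat -> CC :=
  match l with
  | nil => fun m => if Nat.eqb m 0 then C1 else C0
  | (a :: l')%list => mul_linear a (roots_coef l')
  end.

Definition pder (f : nat -> CC) : nat -> CC := fun m => (Cnat (S m) * f (S m))%CC.

Lemma roots_coef_gt (l : list CC) (m : nat) : (length l < m)%nat -> roots_coef l m = C0.
Proof.
  revert m; induction l as [|a l IH]; intros [|m] H; simpl in *; try lia; [reflexivity|].
  unfold mul_linear; rewrite !IH by lia; ring.
Qed.

Lemma roots_coef_lead (l : list CC) : roots_coef l (length l) = C1.
Proof.
  induction l as [|a l IH]; [reflexivity|]; simpl; unfold mul_linear.
  rewrite IH, roots_coef_gt by lia; ring.
Qed.

(** Any chosen root can be brought to the front, so that the product rule for one linear factor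
    gives the derivatives at that root. *)
Lemma roots_coef_perm (l l' : list CC) : Permutation l l' -> roots_coef l = roots_coef l'.
Proof.
  induction 1; simpl; [reflexivity|congruence| |congruence].
  extensionality m; unfold mul_linear; destruct m; ring.
Qed.

Lemma pder_mul_linear (a : CC) (f : nat -> CC) :
  pder (mul_linear a f) = (fun m => f m + mul_linear a (pder f) m)%CC.
Proof.
  extensionality m; unfold pder, mul_linear; destruct m; rewrite ?Cnat_S, ?Cnat_0; ring.
Qed.

Lemma peval_mul_linear (n : nat) (a : CC) (f : nat -> CC) (x : CC) :
  f n = C0 -> peval (S n) (mul_linear a f) x = ((x - a) * peval (S n) f x)%CC.
Proof.
  intros Hn.
  transitivity (x * peval n f x - a * peval (S n) f x)%CC.
  - rewrite peval_first; unfold mul_linear.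
    change (fun m => f m - a * f (S m))%CC with (fun m => f m + - (a * f (S m)))%CC.
    transitivity (C0 - a * f 0%nat + x * (peval n f x - a * peval n (fun m => f (S m)) x))%CC.
    + f_equal; f_equal; unfold peval; rewrite <- Csum_mul_l.
      transitivity (Csum (fun m => f m * x ^ m + (- C1) * (a * (f (S m) * x ^ m)))%CC n).
      * apply Csum_ext; intros; ring.
      * rewrite Csum_add, Csum_mul_l; unfold Csub; ring.
    + rewrite peval_first; ring.
  - unfold peval; simpl; rewrite Hn; ring.
Qed.

Lemma peval_pder_mul_linear (n : nat) (a : CC) (f : nat -> CC) (x : CC) :
  f (S n) = C0 -> f n = C0 ->
  peval (S n) (pder (mul_linear a f)) x
  = (peval (S n) f x + (x - a) * peval (S n) (pder f) x)%CC.
Proof.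
  intros H1 H0; rewrite pder_mul_linear, peval_add, peval_mul_linear; [reflexivity|].
  unfold pder; rewrite H1; ring.
Qed.

(** At x = a only twice the derivative of the cofactor survives; this 2 is the coefficient 2 of the
    logarithms of t_j - t_j' in the master function. *)
Lemma peval_pder2_mul_linear (n : nat) (a : CC) (f : nat -> CC) (x : CC) :
  f (S (S n)) = C0 -> f (S n) = C0 ->
  peval (S n) (pder (pder (mul_linear a f))) x
  = ((C1 + C1) * peval (S n) (pder f) x + (x - a) * peval (S n) (pder (pder f)) x)%CC.
Proof.
  intros H2 H1; rewrite pder_mul_linear.
  replace (pder (fun m => f m + mul_linear a (pder f) m)%CC) with
    (fun m => pder f m + pder (mul_linear a (pder f)) m)%CC
    by (extensionality m; unfold pder; ring).
  rewrite peval_add, peval_pder_mul_linear; [ring| |]; unfold pder; rewrite ?H1, ?H2; ring.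
Qed.

Lemma peval_roots_coef (n : nat) (l : list CC) (x : CC) :
  (length l <= n)%nat ->
  peval (S n) (roots_coef l) x = fold_right Cmul C1 (map (fun a => x - a)%CC l).
Proof.
  induction l as [|a l IH]; intros Hn.
  - unfold peval; rewrite (Csum_single _ _ 0%nat); [simpl; ring|lia|].
    intros [|i] _ Hi; [congruence|simpl; ring].
  - simpl in *; rewrite peval_mul_linear, IH by (try apply roots_coef_gt; lia); reflexivity.
Qed.

Lemma peval_log_derivative (n : nat) (l : list CC) (x : CC) :
  (length l <= n)%nat -> ~ In x l ->
  (peval (S n) (pder (roots_coef l)) x =
   peval (S n) (roots_coef l) x * Clist_sum (map (fun a => C1 / (x - a)) l))%CC.
Proof.
  induction l as [|a l IH]; intros Hn Hx.
  - simpl; unfold peval; rewrite Csum_0; [ring|].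
    intros i _; unfold pder; simpl; ring.
  - simpl in Hn, Hx; cbn [roots_coef map Clist_sum].
    rewrite peval_pder_mul_linear, peval_mul_linear, IH
      by (try apply roots_coef_gt; auto; lia).
    field; apply Csub_neq_0; intros E; apply Hx; left; auto.
Qed.

(** * The differential equation satisfied at a critical point *)

Lemma Csum_list (g : nat -> CC) (k : nat) : Csum g k = Clist_sum (map g (seq 0 k)).
Proof.
  induction k; [reflexivity|].
  rewrite seq_S, map_app, Clist_sum_app, <- IHk; simpl; ring.
Qed.

Lemma fold_Cmul_list (g : nat -> CC) (k : nat) :
  Cprod g k = fold_right Cmul C1 (map g (seq 0 k)).
Proof.
  revert g; induction k; intros g; [reflexivity|].
  rewrite Cprod_first, IHk, <- cons_seq, <- seq_shift, map_cons, map_map; reflexivity.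
Qed.

Lemma seq_split_at (k j : nat) :
  (j < k)%nat -> seq 0 k = (seq 0 j ++ j :: seq (S j) (k - S j))%list.
Proof.
  intros H; replace k with (j + S (k - S j))%nat at 1 by lia.
  rewrite seq_app; reflexivity.
Qed.

(* The coefficient of [x^m] in
   [x (x-1) p'' - (2k x + (xi-1)(x-1)) p' + k (k+xi) p]. *)
Definition ode_coef (k : nat) (xi : CC) (f : nat -> CC) (m : nat) : CC :=
  (f m * ((Cnat m - Cnat k) * (Cnat m - Cnat k - xi))
   - f (S m) * (Cnat (S m) * (Cnat (S m) - xi)))%CC.

Lemma peval_ode_coef (n k : nat) (xi : CC) (f : nat -> CC) (x : CC) :
  f n = C0 -> f (S n) = C0 ->
  peval n (ode_coef k xi f) x =
  (x * (x - C1) * peval n (pder (pder f)) x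
   - (Cnat (2 * k) * x + (xi - C1) * (x - C1)) * peval n (pder f) x
   + Cnat k * (Cnat k + xi) * peval n f x)%CC.
Proof.
  intros H0 H1.
  (* The coefficients of x p', x p'' and x^2 p''; the vanishing of [f n] and [f (S n)] keeps these
     shifts from losing a term. *)
  set (f1 := fun m => (Cnat m * f m)%CC).
  set (f2 := fun m => (Cnat m * pder f m)%CC).
  set (f3 := fun m => (Cnat m * (Cnat m - C1) * f m)%CC).
  assert (E1 : (x * peval n (pder f) x = peval n f1 x)%CC).
  { symmetry; apply (peval_shift n f1); unfold f1; rewrite ?Cnat_0, ?H0; ring. }
  assert (E2 : (x * peval n (pder (pder f)) x = peval n f2 x)%CC).
  { symmetry; apply (peval_shift n f2); unfold f2, pder; rewrite ?Cnat_0, ?H1; ring. }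
  assert (E3 : (x * peval n f2 x = peval n f3 x)%CC).
  { symmetry; rewrite (peval_shift n f3); unfold f3; rewrite ?Cnat_0, ?H0; try ring.
    f_equal; apply peval_ext; intros m _; unfold f2, pder; rewrite Cnat_S; ring. }
  transitivity (peval n f3 x - peval n f2 x
    - (Cnat (2 * k) * peval n f1 x + (xi - C1) * (peval n f1 x - peval n (pder f) x))
    + Cnat k * (Cnat k + xi) * peval n f x)%CC.
  2:{ rewrite <- E3, <- E2, <- E1; ring. }
  transitivity (peval n f3 x + (- C1) * peval n f2 x + - (Cnat (2 * k) + xi - C1) * peval n f1 x
    + (xi - C1) * peval n (pder f) x + Cnat k * (Cnat k + xi) * peval n f x)%CC; [|ring].
  rewrite <- !peval_scale, <- !peval_add; apply peval_ext; intros m _.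
  unfold ode_coef, f1, f2, f3, pder; rewrite Cnat_mul, !Cnat_S, Cnat_0; ring.
Qed.

(** With p = (x - t_j) q one has p' = q and p'' = 2 q' at t_j, so the critical point equation says
    that the differential expression vanishes there. The constant k (k + xi) is the one that cancels
    its coefficient of degree k; a polynomial of degree below k with the k distinct roots t_j is
    zero. *)
Lemma critical_ode_coef (k : nat) (xi : CC) (t : nat -> CC) :
  is_critical k xi t ->
  forall m, (m < k)%nat -> ode_coef k xi (roots_coef (map t (seq 0 k))) m = C0.
Proof.
  intros [Hd [H01 Hc]].
  set (l := map t (seq 0 k)); set (f := roots_coef l).
  assert (Hl : length l = k) by (unfold l; rewrite length_map, length_seq; reflexivity).
  assert (Hgt : forall m, (k < m)%nat -> f m = C0)
    by (intros; apply roots_coef_gt; rewrite Hl; assumption).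
  apply (peval_roots k _ t Hd); intros j Hj.
  (* Root counting needs at most k terms, the expansion into derivatives needs room above degree k;
     the two added coefficients are zero. *)
  assert (E : peval k (ode_coef k xi f) (t j) = peval (S (S k)) (ode_coef k xi f) (t j)).
  { assert (E0 : ode_coef k xi f k = C0)
      by (unfold ode_coef; rewrite (Hgt (S k)) by lia; ring).
    assert (E1 : ode_coef k xi f (S k) = C0)
      by (unfold ode_coef; rewrite (Hgt (S k)), (Hgt (S (S k))) by lia; ring).
    unfold peval; simpl Csum; rewrite E0, E1; ring. }
  rewrite E, peval_ode_coef by (apply Hgt; lia).
  set (l' := (map t (seq 0 j) ++ map t (seq (S j) (k - S j)))%list).
  assert (Hf : f = mul_linear (t j) (roots_coef l')).
  { unfold f; change (mul_linear (t j) (roots_coef l')) with (roots_coef (t j :: l')).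
    apply roots_coef_perm; unfold l, l'; rewrite (seq_split_at k j Hj), map_app; simpl.
    symmetry; apply Permutation_middle. }
  assert (Hl' : (length l' <= k)%nat).
  { unfold l'; rewrite length_app, !length_map, !length_seq; lia. }
  assert (Hgt' : forall m, (k < m)%nat -> roots_coef l' m = C0)
    by (intros; apply roots_coef_gt; lia).
  assert (Hin : ~ In (t j) l').
  { unfold l'; rewrite <- map_app; intros Hin; apply in_map_iff in Hin.
    destruct Hin as [i [Ei Hi]].
    assert (Hi' : (i < k)%nat /\ i <> j)
      by (apply in_app_iff in Hi; rewrite !in_seq in Hi; lia).
    apply (Hd i j); tauto. }
  (* The critical point equation at [t j], with its sum taken over the other roots [l']; the left
     side is p'' / p' at [t j]. *)
  assert (Hs : (CR 2 * Clist_sum (map (fun a => C1 / (t j - a)) l') =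
    Cnat (2 * k) / (t j - C1) + (xi - C1) / t j)%CC).
  { specialize (Hc j Hj); unfold dPhi in Hc.
    set (S1 := Csum _ k) in Hc.
    assert (ES : S1 = (CR 2 * Clist_sum (map (fun a => C1 / (t j - a)) l'))%CC).
    { unfold S1; rewrite Csum_list, (seq_split_at k j Hj), map_app, Clist_sum_app.
      cbn [map Clist_sum]; rewrite Nat.eqb_refl.
      unfold l'; rewrite <- map_app, map_map, map_app, Clist_sum_app.
      assert (Em : forall L, ~ In j L ->
        (Clist_sum (map (fun j' => if Nat.eqb j' j then C0 else CR 2 / (t j - t j')) L)
        = CR 2 * Clist_sum (map (fun i => C1 / (t j - t i)) L))%CC).
      { intros L HL; rewrite <- Clist_sum_map_mul; f_equal; apply map_ext_in; intros i Hi.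
        destruct (Nat.eqb_spec i j) as [->|]; [contradiction|unfold Cdiv; ring]. }
      rewrite !Em by (rewrite in_seq; lia); ring. }
    rewrite <- ES.
    transitivity (S1 - Cnat (2 * k) / (t j - C1) - (xi - C1) / t j
      + (Cnat (2 * k) / (t j - C1) + (xi - C1) / t j))%CC; [ring|].
    rewrite Hc; ring. }
  rewrite Hf, peval_pder2_mul_linear, peval_pder_mul_linear, peval_mul_linear
    by (apply Hgt'; lia).
  rewrite peval_log_derivative by (auto; lia).
  set (q := peval _ _ _); rewrite <- CR_2.
  set (s := Clist_sum _) in *.
  transitivity (t j * (t j - C1) * q * (CR 2 * s)
    - (Cnat (2 * k) * t j + (xi - C1) * (t j - C1)) * q)%CC; [ring|].
  destruct (H01 j Hj) as [Hj0 Hj1].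
  rewrite Hs; field; split; [assumption|apply Csub_neq_0; assumption].
Qed.

(** The product is p(1), the sum of the coefficients of p. Read downwards from the leading
    coefficient 1, the recursion makes it 2F1(-k, xi - k; xi + 1; 1). *)
Lemma critical_prod (k : nat) (xi : CC) (t : nat -> CC) :
  is_critical k xi t ->
  (Cprod (fun j => C1 - t j) k * poch (xi + C1) k = poch (Cnat k + C1) k)%CC.
Proof.
  intros Hcr.
  pose proof (critical_ode_coef k xi t Hcr) as Hode.
  set (f := roots_coef (map t (seq 0 k))) in *.
  assert (Hl : length (map t (seq 0 k)) = k)
    by (rewrite length_map, length_seq; reflexivity).
  assert (E : Cprod (fun j => C1 - t j)%CC k = Csum (fun j => f (k - j)%nat) (S k)).
  { transitivity (peval (S k) f C1).
    - unfold f; rewrite peval_roots_coef by lia.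
      rewrite map_map, fold_Cmul_list; reflexivity.
    - transitivity (Csum f (S k)); [|symmetry; apply (Csum_rev f (S k))].
      apply Csum_ext; intros i _.
      assert (H1 : (C1 ^ i)%CC = C1) by (induction i as [|i IH]; simpl; [|rewrite IH]; ring).
      rewrite H1; ring. }
  rewrite E.
  replace (Cnat k + C1)%CC with ((Cnat k - xi) + (xi + C1))%CC by ring.
  apply chu_vandermonde.
  - rewrite Nat.sub_0_r; unfold f; rewrite <- Hl at 2; apply roots_coef_lead.
  - intros j Hj; specialize (Hode (k - S j)%nat ltac:(lia)); unfold ode_coef in Hode.
    replace (S (k - S j)) with (k - j)%nat in Hode by lia.
    rewrite !Cnat_sub, Cnat_S in * by lia.
    set (a := f (k - S j)%nat) in *; set (b := f (k - j)%nat) in *.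
    transitivity (a * ((Cnat k - (Cnat j + C1) - Cnat k) * (Cnat k - (Cnat j + C1) - Cnat k - xi))
      - b * ((Cnat k - Cnat j) * (Cnat k - Cnat j - xi))
      + b * ((Cnat k - Cnat j) * (Cnat k - xi - Cnat j)))%CC; [ring|].
    rewrite Hode; ring.
Qed.

(** * The function psi *)

Lemma iter_Mf_basisv (l : nat) : Nat.iter l Mf (basisv 0) = basisv l.
Proof.
  induction l as [|l IH]; [reflexivity|].
  simpl; rewrite IH; extensionality j; unfold Mf, basisv.
  destruct j as [|j]; [reflexivity|].
  simpl; rewrite Nat.sub_0_r; reflexivity.
Qed.

Lemma iter_Me (mu : CC) (j n : nat) (x : vec) :
  Nat.iter j (Me mu) x n =
  (Cprod (fun i => Cnat (S (n + i)) * (mu - Cnat (n + i))) j * x (n + j)%nat)%CC.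
Proof.
  revert n; induction j as [|j IH]; intros n.
  - rewrite Nat.add_0_r; simpl; ring.
  - simpl Nat.iter; unfold Me at 1; rewrite Nat.add_1_r, IH, Cprod_first.
    rewrite Nat.add_0_r, Nat.add_succ_r.
    rewrite (Cprod_ext (fun i => Cnat (S (S n + i)) * (mu - Cnat (S n + i)))%CC
      (fun i => Cnat (S (n + S i)) * (mu - Cnat (n + S i)))%CC)
      by (intros; rewrite Nat.add_succ_r; reflexivity).
    simpl Nat.add; ring.
Qed.

(** The norm j! mu (mu - 1) ... (mu - j + 1) of f^j v_mu in the Verma module. *)
Definition Shap_diag (mu : CC) (j : nat) : CC :=
  Cprod (fun i => Cnat (S i) * (mu - Cnat i))%CC j.

Lemma Shap_mu_eq (mu : CC) (j l : nat) :
  Shap_mu mu j l = if Nat.eqb j l then Shap_diag mu j else C0.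
Proof.
  unfold Shap_mu; rewrite iter_Mf_basisv, iter_Me; unfold basisv; simpl Nat.add.
  destruct (Nat.eqb j l); unfold Shap_diag; ring.
Qed.

(** Different powers of f have different weights, so the Gram matrix is diagonal and its block of
    indices up to [k] can be inverted by itself. *)
Lemma Shap_inverse (k : nat) (mu : CC) (Sinv : nat -> nat -> CC) :
  (forall j, (j <= k)%nat -> Shap_diag mu j <> C0) ->
  (forall j l, (j <= k)%nat -> (l <= k)%nat ->
     Csum (fun m => Sinv j m * Shap_mu mu m l)%CC (S k) = if Nat.eqb j l then C1 else C0) ->
  forall j l, (j <= k)%nat -> (l <= k)%nat ->
    Sinv j l = if Nat.eqb j l then Cinv (Shap_diag mu j) else C0.
Proof.
  intros HD H j l Hj Hl; specialize (H j l Hj Hl).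
  rewrite (Csum_single _ _ l) in H.
  2: lia.
  2:{ intros i _ Hi; rewrite Shap_mu_eq, (proj2 (Nat.eqb_neq i l)) by assumption; ring. }
  rewrite Shap_mu_eq, Nat.eqb_refl in H.
  apply (Cmul_cancel_l (Shap_diag mu l)); [auto|].
  transitivity (Sinv j l * Shap_diag mu l)%CC; [ring|]; rewrite H.
  destruct (Nat.eqb_spec j l) as [->|]; [field; auto|ring].
Qed.

Lemma Vf_basisv (k i : nat) (c : CC) :
  (i < 2 * k)%nat -> Vf k (vscale c (basisv i)) = vscale c (basisv (S i)).
Proof.
  intros Hi; extensionality j; unfold Vf, vscale, basisv.
  destruct j as [|j]; cbn [Nat.eqb]; [ring|].
  rewrite Nat.sub_succ, Nat.sub_0_r.
  destruct (Nat.ltb_spec (2 * k) (S j)); destruct (Nat.eqb_spec j i); try ring.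
  lia.
Qed.

Lemma Ve_basisv (k i : nat) (c : CC) :
  (i < 2 * k)%nat ->
  Ve k (vscale c (basisv (S i))) = vscale (c * (Cnat (S i) * Cnat (2 * k - i)))%CC (basisv i).
Proof.
  intros Hi; extensionality j; unfold Ve, vscale, basisv.
  rewrite Nat.add_1_r; cbn [Nat.eqb].
  destruct (Nat.leb_spec (2 * k) j); destruct (Nat.eqb_spec j i); subst; try ring.
  lia.
Qed.

Lemma iter_Vf_basisv (k j i : nat) (c : CC) :
  (i + j <= 2 * k)%nat ->
  Nat.iter j (Vf k) (vscale c (basisv i)) = vscale c (basisv (i + j)).
Proof.
  induction j as [|j IH]; intros H; [rewrite Nat.add_0_r; reflexivity|].
  simpl Nat.iter; rewrite IH, Vf_basisv, Nat.add_succ_r by lia; reflexivity.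
Qed.

(** Since omega(f) = -e, step i starts from the vector of index k - i, where e has the coefficient
    (k - i)(k + i + 1). *)
Lemma iter_Vomega_f_basisv (k l : nat) (c : CC) :
  (l <= k)%nat ->
  Nat.iter l (Vomega_f k) (vscale c (basisv k)) =
  vscale (c * Cprod (fun i => - (Cnat (k - i) * Cnat (S (k + i)))) l)%CC (basisv (k - l)).
Proof.
  induction l as [|l IH]; intros Hl.
  - rewrite Nat.sub_0_r; simpl; f_equal; ring.
  - simpl Nat.iter; rewrite IH by lia.
    unfold Vomega_f; replace (k - l)%nat with (S (k - S l)) at 1 by lia.
    rewrite Ve_basisv by lia.
    replace (S (k - S l)) with (k - l)%nat by lia.
    replace (2 * k - (k - S l))%nat with (S (k + l)) by lia.
    extensionality j; unfold vscale; simpl Cprod; ring.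
Qed.

(** The coefficients of P(z) = 2F1(-k, k + 1; 1 - xi; -z): numerators from f^j omega(f)^j on the
    zero weight vector, denominators from the inverse Shapovalov form. *)
Definition psi_coef (k : nat) (xi : CC) (j : nat) : CC :=
  Cprod (fun i => - (Cnat (k - i) * Cnat (S (k + i)))
                  / (Cnat (S i) * (xi - C1 - Cnat i)))%CC j.

Lemma vsum_at (f : nat -> vec) (n m : nat) : vsum f n m = Csum (fun i => f i m) n.
Proof. induction n as [|n IH]; simpl; [reflexivity|unfold vadd; rewrite IH; reflexivity]. Qed.

Lemma xi_sub_neq_0 (k : nat) (xi : CC) :
  (forall m : nat, (1 <= m <= k)%nat -> xi <> Cnat m) ->
  forall i, (i < k)%nat -> (xi - C1 - Cnat i)%CC <> C0.
Proof.
  intros Hxi i Hi H; apply (Hxi (S i)); [lia|].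
  rewrite Cnat_S; transitivity ((xi - C1 - Cnat i) + (Cnat i + C1))%CC; [ring|].
  rewrite H; ring.
Qed.

(** Only the terms with equal indices survive, and f^j omega(f)^j acts on the zero weight line by a
    scalar. The value [z] is left free so that the same statement serves at [y] and at [- y]. *)
Lemma psi_eq (k : nat) (xi c : CC) (Sinv : nat -> nat -> CC) (y z : CC) :
  (forall m : nat, (1 <= m <= k)%nat -> xi <> Cnat m) ->
  (forall j l : nat, (j <= k)%nat -> (l <= k)%nat ->
     Csum (fun m => Sinv j m * Shap_mu (xi - C1) m l)%CC (S k)
       = (if Nat.eqb j l then C1 else C0)) ->
  (forall m, coefA (Xof y) m = (z ^ m)%CC) ->
  psi k xi Sinv (vscale c (basisv k)) y =
  vscale (Cexp (mkC 0 PI * (xi * y)) * (c * peval (S k) (psi_coef k xi) z))%CC (basisv k).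
Proof.
  intros Hxi HS HA.
  pose proof (xi_sub_neq_0 k xi Hxi) as Hne.
  assert (HD : forall j, (j <= k)%nat -> Shap_diag (xi - C1)%CC j <> C0).
  { intros j Hj; apply Cprod_neq_0; intros i Hi.
    apply Cmul_neq_0; [apply Cnat_S_neq_0|apply Hne; lia]. }
  pose proof (Shap_inverse k _ Sinv HD HS) as HI.
  extensionality m; unfold psi.
  change (vscale ?a ?b m) with (a * b m)%CC; change (vscale ?a ?b m) with (a * b m)%CC.
  rewrite vsum_at.
  set (E := Cexp _).
  transitivity (E * (c * basisv k m * peval (S k) (psi_coef k xi) z))%CC; [|ring].
  f_equal; unfold peval; rewrite <- Csum_mul_l; apply Csum_ext; intros j Hj.
  rewrite vsum_at, (Csum_single _ _ j); [|assumption|].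
  - rewrite iter_Vomega_f_basisv, iter_Vf_basisv by lia.
    replace (k - j + j)%nat with k by lia.
    rewrite HI, Nat.eqb_refl, HA by lia.
    assert (EQ : (Cprod (fun i => - (Cnat (k - i) * Cnat (S (k + i)))) j
      * Cinv (Shap_diag (xi - C1) j))%CC = psi_coef k xi j).
    { unfold Shap_diag; rewrite <- Cprod_Cinv, <- Cprod_mul; [reflexivity|].
      intros i Hi; apply Cmul_neq_0; [apply Cnat_S_neq_0|apply Hne; lia]. }
    rewrite <- EQ; unfold vscale; ring.
  - intros l Hl Hlj; rewrite HI, (proj2 (Nat.eqb_neq j l)) by lia.
    unfold vscale; ring.
Qed.

(** At z = -1 the hypergeometric series has argument 1, and B + c = -(k + xi). Turning both
    Pochhammer symbols into the products of the statement costs a sign (-1)^k on each side. *)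
Lemma peval_psi_coef (k : nat) (xi : CC) :
  (forall m : nat, (1 <= m <= k)%nat -> xi <> Cnat m) ->
  (peval (S k) (psi_coef k xi) (- C1)%CC * Cprod (fun m => xi - Cnat (S m)) k
   = Cprod (fun m => xi + Cnat (S m)) k)%CC.
Proof.
  intros Hxi; pose proof (xi_sub_neq_0 k xi Hxi) as Hne.
  assert (H : (peval (S k) (psi_coef k xi) (- C1) * poch (C1 - xi) k
    = poch (- (Cnat k + C1) + (C1 - xi)) k)%CC).
  { apply chu_vandermonde; [unfold psi_coef; simpl; ring|].
    intros j Hj; simpl Cpow.
    change (psi_coef k xi (S j)) with (psi_coef k xi j *
      (- (Cnat (k - j) * Cnat (S (k + j))) / (Cnat (S j) * (xi - C1 - Cnat j))))%CC.
    rewrite (Cnat_S (k + j)), Cnat_add.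
    field; split; [apply Hne; assumption|apply Cnat_S_neq_0]. }
  set (e := Cprod (fun _ => - C1)%CC k).
  assert (He : (e * e = C1)%CC) by apply Cprod_neg_one.
  assert (H1 : poch (C1 - xi)%CC k = (e * Cprod (fun m => xi - Cnat (S m)) k)%CC).
  { unfold poch, e; rewrite <- Cprod_mul; apply Cprod_ext; intros; rewrite Cnat_S; ring. }
  assert (H2 : poch (- (Cnat k + C1) + (C1 - xi))%CC k
    = (e * Cprod (fun m => xi + Cnat (S m)) k)%CC).
  { rewrite <- (Cprod_rev (fun m => xi + Cnat (S m))%CC).
    unfold poch, e; rewrite <- Cprod_mul; apply Cprod_ext; intros i Hi.
    replace (S (k - S i)) with (k - i)%nat by lia; rewrite Cnat_sub by lia; ring. }
  rewrite H1, H2 in H.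
  set (p := peval _ _ _) in *.
  transitivity ((e * e) * (p * Cprod (fun m => xi - Cnat (S m)) k))%CC; [rewrite He; ring|].
  transitivity (e * (p * (e * Cprod (fun m => xi - Cnat (S m)) k)))%CC; [ring|].
  rewrite H; transitivity ((e * e) * Cprod (fun m => xi + Cnat (S m)) k)%CC; [ring|].
  rewrite He; ring.
Qed.

(** * The Shapovalov form of V on weight vectors *)

Lemma bilin_basisv (k i j : nat) (G : nat -> nat -> CC) (a b : CC) :
  (i <= 2 * k)%nat -> (j <= 2 * k)%nat ->
  bilin k G (vscale a (basisv i)) (vscale b (basisv j)) = (a * b * G i j)%CC.
Proof.
  intros Hi Hj; unfold bilin.
  rewrite (Csum_single _ _ i), (Csum_single _ _ j); [| lia | | lia |].
  - unfold vscale, basisv; rewrite !Nat.eqb_refl; ring.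
  - intros l _ Hl; unfold vscale, basisv at 2.
    rewrite (proj2 (Nat.eqb_neq l j)) by assumption; ring.
  - intros l _ Hl; apply Csum_0; intros m _; unfold vscale, basisv at 1.
    rewrite (proj2 (Nat.eqb_neq l i)) by assumption; ring.
Qed.

(** Contravariance moves one f across the form as e, which lowers both arguments by one step. *)
Lemma Shapovalov_V_diag (k : nat) (G : nat -> nat -> CC) (j : nat) :
  is_Shapovalov_V k G -> (j <= 2 * k)%nat ->
  G j j = Cprod (fun i => Cnat (S i) * Cnat (2 * k - i))%CC j.
Proof.
  intros [H0 [_ [_ [Hf _]]]]; induction j as [|j IH]; intros Hj; [assumption|].
  specialize (Hf (vscale C1 (basisv j)) (vscale C1 (basisv (S j)))).
  rewrite Vf_basisv, Ve_basisv, !bilin_basisv in Hf by lia.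
  transitivity (G j j * (Cnat (S j) * Cnat (2 * k - j)))%CC; [|rewrite IH by lia; reflexivity].
  transitivity (C1 * C1 * G (S j) (S j))%CC; [ring|].
  rewrite Hf; ring.
Qed.

(** * Integration along a line *)

Definition is_CCderive (F : R -> CC) (s : R) (D : CC) : Prop :=
  is_derive (fun s => Cre (F s)) s (Cre D) /\ is_derive (fun s => Cim (F s)) s (Cim D).

Definition is_CCRInt (F : R -> CC) (a b : R) (I : CC) : Prop :=
  is_RInt (fun s => Cre (F s)) a b (Cre I) /\ is_RInt (fun s => Cim (F s)) a b (Cim I).

Lemma is_CCRInt_cint (F : R -> CC) (a b : R) (I : CC) : is_CCRInt F a b I -> is_cint F a b I.
Proof.
  intros [H1 H2].
  exists (ex_RInt_Reals_0 _ _ _ (ex_intro _ _ H1)), (ex_RInt_Reals_0 _ _ _ (ex_intro _ _ H2)).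
  rewrite <- !RInt_Reals; split; apply is_RInt_unique; assumption.
Qed.

Lemma is_CCRInt_ext (F H : R -> CC) (a b : R) (I : CC) :
  (forall s, F s = H s) -> is_CCRInt F a b I -> is_CCRInt H a b I.
Proof. intros E; replace H with F by (extensionality s; apply E); auto. Qed.

Lemma is_CCRInt_add (F H : R -> CC) (a b : R) (I J : CC) :
  is_CCRInt F a b I -> is_CCRInt H a b J ->
  is_CCRInt (fun s => F s + H s)%CC a b (I + J)%CC.
Proof.
  intros [H1 H2] [H3 H4]; split; simpl.
  - exact (is_RInt_plus (V := R_NormedModule) _ _ _ _ _ _ H1 H3).
  - exact (is_RInt_plus (V := R_NormedModule) _ _ _ _ _ _ H2 H4).
Qed.

Lemma is_CCRInt_scale (c : CC) (F : R -> CC) (a b : R) (I : CC) :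
  is_CCRInt F a b I -> is_CCRInt (fun s => c * F s)%CC a b (c * I)%CC.
Proof.
  intros [H1 H2]; split; simpl.
  - exact (is_RInt_minus (V := R_NormedModule) _ _ _ _ _ _
      (is_RInt_scal (V := R_NormedModule) _ _ _ (Cre c) _ H1)
      (is_RInt_scal (V := R_NormedModule) _ _ _ (Cim c) _ H2)).
  - exact (is_RInt_plus (V := R_NormedModule) _ _ _ _ _ _
      (is_RInt_scal (V := R_NormedModule) _ _ _ (Cre c) _ H2)
      (is_RInt_scal (V := R_NormedModule) _ _ _ (Cim c) _ H1)).
Qed.

Lemma is_CCRInt_const (c : CC) : is_CCRInt (fun _ => c) 0 1 c.
Proof.
  split; [evar_last; [exact (is_RInt_const (V := R_NormedModule) 0 1 (Cre c))|]
         |evar_last; [exact (is_RInt_const (V := R_NormedModule) 0 1 (Cim c))|]];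
    unfold scal; simpl; unfold mult; simpl; ring.
Qed.

(** The fundamental theorem of calculus; the second hypothesis serves to make [D] continuous. *)
Lemma is_CCRInt_derive (F D : R -> CC) (a b : R) :
  (forall s, is_CCderive F s (D s)) ->
  (forall s, exists D', is_CCderive D s D') ->
  is_CCRInt D a b (F b - F a)%CC.
Proof.
  intros HF HD; split.
  - apply (is_RInt_derive (V := R_CompleteNormedModule) (fun s => Cre (F s))).
    + intros s _; apply HF.
    + intros s _; apply (ex_derive_continuous (V := R_NormedModule)).
      destruct (HD s) as [D' [H _]]; eexists; exact H.
  - apply (is_RInt_derive (V := R_CompleteNormedModule) (fun s => Cim (F s))).
    + intros s _; apply HF.
    + intros s _; apply (ex_derive_continuous (V := R_NormedModule)).
      destruct (HD s) as [D' [_ H]]; eexists; exact H.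
Qed.

Lemma is_CCderive_eq (F : R -> CC) (s : R) (D D' : CC) :
  D = D' -> is_CCderive F s D -> is_CCderive F s D'.
Proof. intros <-; auto. Qed.

Lemma is_CCderive_const (c : CC) (s : R) : is_CCderive (fun _ => c) s C0.
Proof. split; apply (is_derive_const (V := R_NormedModule)). Qed.

Lemma is_CCderive_add (F H : R -> CC) (s : R) (D E : CC) :
  is_CCderive F s D -> is_CCderive H s E -> is_CCderive (fun s => F s + H s)%CC s (D + E)%CC.
Proof.
  intros [H1 H2] [H3 H4]; split; simpl;
    apply (is_derive_plus (V := R_NormedModule)); assumption.
Qed.

(** Turns a complex function into two real function variables, which [auto_derive] can treat as
    atoms. *)
Lemma CC_fun_split (F : R -> CC) : exists f g : R -> R, F = fun s => mkC (f s) (g s).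
Proof.
  exists (fun s => Cre (F s)), (fun s => Cim (F s)).
  extensionality s; apply CC_ext; reflexivity.
Qed.

Lemma is_CCderive_mul (F H : R -> CC) (s : R) (D E : CC) :
  is_CCderive F s D -> is_CCderive H s E ->
  is_CCderive (fun s => F s * H s)%CC s (D * H s + F s * E)%CC.
Proof.
  destruct (CC_fun_split F) as [f [g ->]], (CC_fun_split H) as [h [i ->]].
  intros [H1 H2] [H3 H4]; simpl in H1, H2, H3, H4; split; simpl.
  - auto_derive; [repeat split; eexists; eassumption|].
    erewrite !is_derive_unique by eassumption; ring.
  - auto_derive; [repeat split; eexists; eassumption|].
    erewrite !is_derive_unique by eassumption; ring.
Qed.

Lemma is_CCderive_inv (F : R -> CC) (s : R) (D : CC) :
  F s <> C0 -> is_CCderive F s D ->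
  is_CCderive (fun s => Cinv (F s)) s (- (D / (F s * F s)))%CC.
Proof.
  destruct (CC_fun_split F) as [f [g ->]].
  intros HF [H1 H2]; simpl in H1, H2; pose proof (sum_sqr_pos _ HF) as Hp; simpl in Hp; split; simpl.
  - auto_derive; [repeat split; try (eexists; eassumption); lra|].
    erewrite !is_derive_unique by eassumption; field; nra.
  - auto_derive; [repeat split; try (eexists; eassumption); lra|].
    erewrite !is_derive_unique by eassumption; field; nra.
Qed.

(** The principal logarithm on the right half-plane, where the argument is the arctangent of Im /
    Re. *)
Lemma is_CCderive_log (F : R -> CC) (s : R) (D : CC) :
  0 < Cre (F s) -> is_CCderive F s D ->
  is_CCderive (fun s => mkC (ln (Cre (F s) * Cre (F s) + Cim (F s) * Cim (F s)) / 2)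
                            (atan (Cim (F s) / Cre (F s)))) s (D / F s)%CC.
Proof.
  destruct (CC_fun_split F) as [f [g ->]].
  intros HF [H1 H2]; simpl in HF, H1, H2; split; simpl.
  - auto_derive; [repeat split; try (eexists; eassumption); nra|].
    erewrite !is_derive_unique by eassumption; field; nra.
  - auto_derive; [repeat split; try (eexists; eassumption); lra|].
    erewrite !is_derive_unique by eassumption; field; nra.
Qed.

(** * Squared modulus and exponential *)

Definition norm2 (z : CC) : R := Cre z * Cre z + Cim z * Cim z.

Lemma norm2_pow_lt_1 (z : CC) (n : nat) : norm2 z < 1 -> norm2 (z ^ S n)%CC < 1.
Proof.
  assert (Hnn : forall w, 0 <= norm2 w) by (intros w; unfold norm2; nra).
  assert (Hm : forall w v, norm2 (w * v)%CC = norm2 w * norm2 v)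
    by (intros; unfold norm2; simpl; ring).
  intros Hz; induction n as [|n IH].
  - simpl; rewrite Hm; replace (norm2 C1) with 1 by (unfold norm2; simpl; ring); lra.
  - change (z ^ S (S n))%CC with (z ^ S n * z)%CC; rewrite Hm.
    pose proof (Hnn z); pose proof (Hnn (z ^ S n)%CC); nra.
Qed.

Lemma Cpow_neq_1 (z : CC) (n : nat) : norm2 z < 1 -> (z ^ S n)%CC <> C1.
Proof.
  intros Hz E; pose proof (norm2_pow_lt_1 z n Hz) as H; rewrite E in H.
  unfold norm2 in H; simpl in H; lra.
Qed.

Lemma Cpow_Cinv_neq_1 (z : CC) (n : nat) : z <> C0 -> norm2 z < 1 -> (Cinv z ^ S n)%CC <> C1.
Proof.
  intros Hz0 Hz E; apply (Cpow_neq_1 z n Hz).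
  rewrite Cpow_Cinv in E by assumption.
  pose proof (Cpow_neq_0 z (S n) Hz0) as Hn; set (w := (z ^ S n)%CC) in *.
  transitivity (w * Cinv w)%CC; [rewrite E; ring|field; assumption].
Qed.

Lemma Cexp_add (z w : CC) : Cexp (z + w)%CC = (Cexp z * Cexp w)%CC.
Proof.
  apply CC_ext; simpl; rewrite exp_plus; [rewrite cos_plus|rewrite sin_plus]; ring.
Qed.

Lemma Cexp_0 : Cexp C0 = C1.
Proof. apply CC_ext; simpl; rewrite exp_0; [rewrite cos_0|rewrite sin_0]; ring. Qed.

Lemma norm2_Cexp (z : CC) : norm2 (Cexp z) = exp (2 * Cre z).
Proof.
  pose proof (sin2_cos2 (Cim z)) as H; unfold Rsqr in H.
  unfold norm2; simpl; replace (2 * Cre z) with (Cre z + Cre z) by ring.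
  rewrite exp_plus.
  transitivity (exp (Cre z) * exp (Cre z) *
    (sin (Cim z) * sin (Cim z) + cos (Cim z) * cos (Cim z))); [ring|rewrite H; ring].
Qed.

Lemma Cexp_neq_0 (z : CC) : Cexp z <> C0.
Proof.
  intros E; pose proof (norm2_Cexp z) as H; rewrite E in H.
  unfold norm2 in H; simpl in H; pose proof (exp_pos (2 * Cre z)); lra.
Qed.

Lemma Xof_opp (y : CC) : Xof (- y)%CC = Cinv (Xof y).
Proof.
  assert (H : (Xof y * Xof (- y) = C1)%CC).
  { unfold Xof; rewrite <- Cexp_add, <- Cexp_0; apply f_equal.
    set (c := mkC _ _); ring. }
  apply (Cmul_cancel_l (Xof y)); [apply Cexp_neq_0|].
  rewrite H; field; apply Cexp_neq_0.
Qed.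

(** * The line of integration in the coordinates X and z *)

Definition lower_line (delta s : R) : CC := mkC s (- delta).

(** Here |X| = exp(-2 pi delta): the line has to run below the real axis. *)
Lemma norm2_Xof (delta s : R) : delta > 0 -> norm2 (Xof (lower_line delta s)) < 1.
Proof.
  intros Hd; unfold Xof; rewrite norm2_Cexp, <- exp_0; apply exp_increasing.
  simpl; pose proof PI_RGT_0; nra.
Qed.

Definition zline (delta s : R) : CC :=
  (Xof (lower_line delta s) / (C1 - Xof (lower_line delta s)))%CC.

Definition m2pii : CC := mkC 0 (-2 * PI).

Lemma m2pii_neq_0 : m2pii <> C0.
Proof. intros E; apply (f_equal Cim) in E; simpl in E; pose proof PI_RGT_0; lra. Qed.

Lemma is_CCderive_Xof (delta s : R) :
  is_CCderive (fun s => Xof (lower_line delta s)) s (m2pii * Xof (lower_line delta s))%CC.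
Proof. split; simpl; auto_derive; auto; unfold Rminus; ring. Qed.

Lemma is_CCderive_one_sub_Xof (delta s : R) :
  is_CCderive (fun s => C1 - Xof (lower_line delta s))%CC s
    (- (m2pii * Xof (lower_line delta s)))%CC.
Proof.
  unfold Csub.
  apply is_CCderive_eq with (C0 + (C0 * Xof (lower_line delta s) +
    (- C1) * (m2pii * Xof (lower_line delta s))))%CC; [ring|].
  replace (fun s => C1 + - Xof (lower_line delta s))%CC
    with (fun s => C1 + (- C1) * Xof (lower_line delta s))%CC
    by (extensionality x; ring).
  apply (is_CCderive_add (fun _ => C1)); [apply is_CCderive_const|].
  apply (is_CCderive_mul (fun _ => - C1)%CC);
    [apply is_CCderive_const|apply is_CCderive_Xof].
Qed.

(** Since |X| < 1, the point 1 - X stays in the right half-plane, where the principal logarithm is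
    available. *)
Lemma one_sub_Xof_pos (delta s : R) :
  delta > 0 -> 0 < Cre (C1 - Xof (lower_line delta s))%CC.
Proof.
  intros Hd; pose proof (norm2_Xof delta s Hd) as H; unfold norm2 in H.
  destruct (Xof _) as [a b]; simpl in *; nra.
Qed.

Lemma one_sub_Xof_neq_0 (delta s : R) :
  delta > 0 -> (C1 - Xof (lower_line delta s))%CC <> C0.
Proof.
  intros Hd E; pose proof (one_sub_Xof_pos delta s Hd) as H; rewrite E in H.
  simpl in H; lra.
Qed.

(** As 1 + z = 1 / (1 - X), the derivative X' / (1 - X)^2 is again a polynomial in z. *)
Lemma is_CCderive_zline (delta s : R) :
  delta > 0 ->
  is_CCderive (zline delta) s (m2pii * (zline delta s * (C1 + zline delta s)))%CC.
Proof.
  intros Hd; pose proof (one_sub_Xof_neq_0 delta s Hd) as Hne.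
  eapply is_CCderive_eq.
  2:{ apply (is_CCderive_mul (fun s => Xof (lower_line delta s))
        (fun s => Cinv (C1 - Xof (lower_line delta s))%CC)).
      - apply is_CCderive_Xof.
      - apply (is_CCderive_inv (fun s => C1 - Xof (lower_line delta s))%CC);
          [assumption|apply is_CCderive_one_sub_Xof]. }
  unfold zline; field; assumption.
Qed.

Lemma is_CCderive_zline_pow (delta s : R) (n : nat) :
  delta > 0 ->
  is_CCderive (fun s => zline delta s ^ n)%CC s
    (m2pii * Cnat n * (zline delta s ^ n + zline delta s ^ S n))%CC.
Proof.
  intros Hd; induction n as [|n IH].
  - apply is_CCderive_eq with C0; [rewrite Cnat_0; ring|exact (is_CCderive_const C1 s)].
  - eapply is_CCderive_eq.
    2: exact (is_CCderive_mul _ _ _ _ _ IH (is_CCderive_zline delta s Hd)).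
    rewrite Cnat_S; set (z := zline delta s); simpl; ring.
Qed.

Lemma lower_line_Xof_periodic (delta : R) : Xof (lower_line delta 1) = Xof (lower_line delta 0).
Proof.
  assert (Hc : cos (-2 * PI) = 1)
    by (replace (-2 * PI) with (- (2 * PI)) by ring; rewrite cos_neg; apply cos_2PI).
  assert (Hs : sin (-2 * PI) = 0)
    by (replace (-2 * PI) with (- (2 * PI)) by ring; rewrite sin_neg, sin_2PI; ring).
  apply CC_ext; simpl;
    replace (0 * 1 - -2 * PI * - delta) with (0 * 0 - -2 * PI * - delta) by ring;
    f_equal.
  - replace (0 * - delta + -2 * PI * 1) with (-2 * PI) by ring.
    replace (0 * - delta + -2 * PI * 0) with 0 by ring.
    rewrite Hc, cos_0; reflexivity.
  - replace (0 * - delta + -2 * PI * 1) with (-2 * PI) by ring.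
    replace (0 * - delta + -2 * PI * 0) with 0 by ring.
    rewrite Hs, sin_0; reflexivity.
Qed.

(* Since [X = 0] is the point [z = 0], this is the mean value property; by
   [z' = -2 pi i z (1 + z)] all powers reduce to [z], the logarithmic
   derivative of [1 - X] up to a constant. *)
Lemma zline_pow_integral (delta : R) (n : nat) :
  delta > 0 -> is_CCRInt (fun s => zline delta s ^ S n)%CC 0 1 C0.
Proof.
  intros Hd; induction n as [|n IH].
  (* A branch of log(1 - X). It depends on X alone, so it takes the same value at both ends and no
     winding term appears. *)
  - set (L := fun s => let w := (C1 - Xof (lower_line delta s))%CC in
      mkC (ln (Cre w * Cre w + Cim w * Cim w) / 2) (atan (Cim w / Cre w))).
    assert (HL : forall s, is_CCderive L s (- m2pii * zline delta s)%CC).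
    { intros s; eapply is_CCderive_eq.
      2:{ apply (is_CCderive_log (fun s => C1 - Xof (lower_line delta s))%CC);
          [apply one_sub_Xof_pos; assumption|apply is_CCderive_one_sub_Xof]. }
      unfold zline; field; apply one_sub_Xof_neq_0; assumption. }
    pose proof (is_CCRInt_derive L (fun s => - m2pii * zline delta s)%CC 0 1 HL) as HI.
    replace (L 1 - L 0)%CC with C0 in HI
      by (unfold L; rewrite lower_line_Xof_periodic; ring).
    replace C0 with (Cinv (- m2pii) * C0)%CC by ring.
    apply is_CCRInt_ext with (fun s => Cinv (- m2pii) * (- m2pii * zline delta s))%CC.
    + intros s; simpl; field; intros E; apply m2pii_neq_0.
      transitivity (- - m2pii)%CC; [ring|rewrite E; ring].
    + apply is_CCRInt_scale, HI; intros s; eexists.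
      apply (is_CCderive_mul (fun _ => - m2pii)%CC);
        [apply is_CCderive_const|apply is_CCderive_zline; assumption].
  (* Up to [c], the sum of the powers n + 1 and n + 2 is the derivative of the periodic function
     z^(n+1), so both have opposite integrals. *)
  - set (c := (m2pii * Cnat (S n))%CC).
    assert (Hc : c <> C0) by (apply Cmul_neq_0; [apply m2pii_neq_0|apply Cnat_S_neq_0]).
    pose proof (is_CCRInt_derive (fun s => zline delta s ^ S n)%CC
      (fun s => c * (zline delta s ^ S n + zline delta s ^ S (S n)))%CC 0 1
      (fun s => is_CCderive_zline_pow delta s (S n) Hd)) as HI.
    cbv beta in HI.
    replace (zline delta 1 ^ S n - zline delta 0 ^ S n)%CC with C0 in HI
      by (unfold zline; rewrite lower_line_Xof_periodic; ring).
    replace C0 with (Cinv c * C0 + - C1 * C0)%CC by ring.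
    apply is_CCRInt_ext with (fun s =>
      Cinv c * (c * (zline delta s ^ S n + zline delta s ^ S (S n)))
      + - C1 * zline delta s ^ S n)%CC.
    + intros s; field; assumption.
    + apply is_CCRInt_add; apply is_CCRInt_scale; [|exact IH].
      apply HI; intros s; eexists.
      apply (is_CCderive_mul (fun _ => c)); [apply is_CCderive_const|].
      apply is_CCderive_add; apply is_CCderive_zline_pow; assumption.
Qed.

(* Quantifying over [n] makes this property stable under multiplication by [z],
   hence valid for all polynomials. *)
Definition mean_value (delta : R) (g : CC -> CC) : Prop :=
  forall n, is_CCRInt (fun s => zline delta s ^ n * g (zline delta s))%CC 0 1 (C0 ^ n * g C0)%CC.

Lemma mean_value_1 (delta : R) : delta > 0 -> mean_value delta (fun _ => C1).
Proof.
  intros Hd [|n].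
  - eapply is_CCRInt_ext; [|apply (is_CCRInt_const (C1 * C1)%CC)]; reflexivity.
  - apply is_CCRInt_ext with (fun s => zline delta s ^ S n)%CC; [intros; ring|].
    replace (C0 ^ S n * C1)%CC with C0 by (simpl; ring).
    apply zline_pow_integral; assumption.
Qed.

Lemma mean_value_mul_id (delta : R) (g : CC -> CC) :
  mean_value delta g -> mean_value delta (fun z => z * g z)%CC.
Proof.
  intros H n; replace (C0 ^ n * (C0 * g C0))%CC with (C0 ^ S n * g C0)%CC by (simpl; ring).
  eapply is_CCRInt_ext; [|apply (H (S n))]; intros s; simpl; ring.
Qed.

Lemma mean_value_add (delta : R) (g h : CC -> CC) :
  mean_value delta g -> mean_value delta h -> mean_value delta (fun z => g z + h z)%CC.
Proof.
  intros Hg Hh n.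
  replace (C0 ^ n * (g C0 + h C0))%CC with (C0 ^ n * g C0 + C0 ^ n * h C0)%CC by ring.
  eapply is_CCRInt_ext; [|apply (is_CCRInt_add _ _ _ _ _ _ (Hg n) (Hh n))].
  intros s; simpl; ring.
Qed.

Lemma mean_value_scale (delta : R) (c : CC) (g : CC -> CC) :
  mean_value delta g -> mean_value delta (fun z => c * g z)%CC.
Proof.
  intros Hg n.
  replace (C0 ^ n * (c * g C0))%CC with (c * (C0 ^ n * g C0))%CC by ring.
  eapply is_CCRInt_ext; [|apply (is_CCRInt_scale c _ _ _ _ (Hg n))].
  intros s; simpl; ring.
Qed.

Lemma mean_value_sum (delta : R) (g : nat -> CC -> CC) (n : nat) :
  delta > 0 -> (forall i, mean_value delta (g i)) ->
  mean_value delta (fun z => Csum (fun i => g i z) n).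
Proof.
  intros Hd Hg; induction n as [|n IH]; simpl.
  - replace (fun _ : CC => C0) with (fun _ : CC => C0 * C1)%CC by (extensionality z; ring).
    apply mean_value_scale, mean_value_1, Hd.
  - apply mean_value_add; auto.
Qed.

Lemma mean_value_ext (delta : R) (g h : CC -> CC) :
  (forall z, g z = h z) -> mean_value delta g -> mean_value delta h.
Proof. intros E; replace h with g by (extensionality z; apply E); auto. Qed.

(** The reflected factor is again a polynomial in z, so the product arises from 1 by sums, scalars
    and multiplication by z. *)
Lemma mean_value_peval (delta : R) (n : nat) (f : nat -> CC) :
  delta > 0 ->
  mean_value delta (fun z => peval n f z * peval n f (- C1 - z))%CC.
Proof.
  intros Hd.
  assert (H1 : forall j, mean_value delta (fun z => (- C1 - z) ^ j)%CC).
  { induction j as [|j IH]; [apply mean_value_1; assumption|].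
    apply mean_value_ext with (fun z => (- C1) * (- C1 - z) ^ j
      + (- C1) * (z * (- C1 - z) ^ j))%CC; [intros; simpl; ring|].
    apply mean_value_add; apply mean_value_scale; [|apply mean_value_mul_id]; exact IH. }
  assert (H2 : mean_value delta (fun z => peval n f (- C1 - z))%CC)
    by (apply mean_value_sum; [assumption|intros; apply mean_value_scale, H1]).
  assert (H3 : forall j, mean_value delta (fun z => z ^ j * peval n f (- C1 - z))%CC).
  { induction j as [|j IH].
    - eapply mean_value_ext; [|exact H2]; intros; simpl; ring.
    - eapply mean_value_ext; [|apply mean_value_mul_id, IH]; intros; simpl; ring. }
  apply mean_value_ext with
    (fun z => Csum (fun j => f j * (z ^ j * peval n f (- C1 - z))) n)%CC.
  - intros z; set (p := peval n f (- C1 - z)%CC).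
    transitivity (p * peval n f z)%CC; [|ring].
    unfold peval; rewrite <- Csum_mul_l; apply Csum_ext; intros; ring.
  - apply mean_value_sum; [assumption|intros; apply mean_value_scale, H3].
Qed.

(** * The pairing *)

Lemma Cprod_rising_fact (k : nat) :
  Cprod (fun i => Cnat (S i) * Cnat (2 * k - i))%CC k
  = (Cnat (fact k) * Cprod (fun m => Cnat (k + S m)) k)%CC.
Proof.
  rewrite Cprod_mul, Cnat_fact; f_equal.
  rewrite <- (Cprod_rev (fun m => Cnat (k + S m))).
  apply Cprod_ext; intros i Hi; f_equal; lia.
Qed.

(** The two exponential prefactors are inverse to each other. At [- y] the variable X becomes 1/X
    and X / (1 - X) becomes 1 / (X - 1) = -1 - z; since |1/X| > 1, no positive power of it is 1 and
    the formula for A_X applies there too. *)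
Lemma psi_pairing_integrand (k : nat) (xi c : CC) (Sinv G : nat -> nat -> CC) (delta s : R) :
  (forall m : nat, (1 <= m <= k)%nat -> xi <> Cnat m) ->
  (forall j l : nat, (j <= k)%nat -> (l <= k)%nat ->
     Csum (fun m => Sinv j m * Shap_mu (xi - C1) m l)%CC (S k)
       = (if Nat.eqb j l then C1 else C0)) ->
  delta > 0 ->
  let u := vscale c (basisv k) in
  let z := zline delta s in
  bilin k G (psi k xi Sinv u (lower_line delta s)) (psi k xi Sinv u (- lower_line delta s)%CC)
  = (c * c * G k k * (peval (S k) (psi_coef k xi) z * peval (S k) (psi_coef k xi) (- C1 - z)))%CC.
Proof.
  intros Hxi HS Hd u z; unfold u.
  set (y := lower_line delta s).
  pose proof (norm2_Xof delta s Hd) as HX; fold y in HX.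
  pose proof (one_sub_Xof_neq_0 delta s Hd) as H1; fold y in H1.
  assert (HX0 : Xof y <> C0) by apply Cexp_neq_0.
  rewrite (psi_eq k xi c Sinv y z Hxi HS), (psi_eq k xi c Sinv (- y)%CC (- C1 - z)%CC Hxi HS).
  - rewrite bilin_basisv by lia.
    set (P := peval _ _ z); set (P' := peval _ _ (- C1 - z)%CC).
    set (a := mkC 0 PI).
    assert (HE : (Cexp (a * (xi * y)) * Cexp (a * (xi * - y)) = C1)%CC).
    { rewrite <- Cexp_add, <- Cexp_0; apply f_equal; ring. }
    transitivity ((Cexp (a * (xi * y)) * Cexp (a * (xi * - y))) * (c * c * G k k * (P * P')))%CC;
      [ring|rewrite HE; ring].
  - intros m; rewrite Xof_opp, coefA_eq by (intros; apply Cpow_Cinv_neq_1; assumption).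
    f_equal; unfold z, zline; fold y; field; repeat split; try assumption.
    change (Xof y - C1 <> C0)%CC; intros E; apply H1.
    transitivity (- (Xof y - C1))%CC; [ring|rewrite E; ring].
  - intros m; rewrite coefA_eq by (intros; apply Cpow_neq_1; assumption); reflexivity.
Qed.

Theorem theorem9p2 (k : nat) (xi1 : CC)
  (Hxi : forall m : nat, (1 <= m <= k)%nat -> xi1 <> Cnat m)
  (t : nat -> CC) (Ht : is_isolated_critical k xi1 t)
  (G : nat -> nat -> CC) (HG : is_Shapovalov_V k G)
  (Sinv : nat -> nat -> CC)
  (HSinv : forall j l : nat, (j <= k)%nat -> (l <= k)%nat ->
     Csum (fun m => Cmul (Sinv j m) (Shap_mu (Csub xi1 C1) m l)) (S k)
       = (if Nat.eqb j l then C1 else C0) /\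
     Csum (fun m => Cmul (Shap_mu (Csub xi1 C1) j m) (Sinv m l)) (S k)
       = (if Nat.eqb j l then C1 else C0))
  (u : vec)
  (Hu : u = vscale (Cprod (fun j => Cinv (Csub (t j) C1)) k) (basisv k))
  (delta : R) (Hdelta : delta > 0) :
  pairing_is k G (psi k xi1 Sinv u) (psi k xi1 Sinv u) delta
    (Cdiv
       (Cmul (Cpow (Cprod (fun m => Cadd xi1 (Cnat (S m))) k) 3) (Cnat (fact k)))
       (Cmul (Cprod (fun m => Csub xi1 (Cnat (S m))) k)
             (Cprod (fun m => Cnat (k + S m)) k))).
Proof.
  destruct Ht as [Hcr _].
  pose proof (critical_prod k xi1 t Hcr) as Hp.
  destruct Hcr as [_ [Ht01 _]].
  pose proof (peval_psi_coef k xi1 Hxi) as HP.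
  set (c := Cprod (fun j => Cinv (t j - C1)%CC) k) in *.
  set (q := psi_coef k xi1) in *.
  set (T := Cprod (fun j => C1 - t j)%CC k) in *.
  (* The sign (-1)^k between the factors t_j - 1 of the Bethe vector and the factors 1 - t_j of
     p(1). *)
  set (e := Cprod (fun _ => - C1)%CC k).
  assert (Ht1 : forall j, (j < k)%nat -> (t j - C1)%CC <> C0)
    by (intros j Hj; apply Csub_neq_0, Ht01, Hj).
  assert (HcT : (e * (c * T) = C1)%CC).
  { unfold e, c, T; rewrite <- !Cprod_mul.
    rewrite (Cprod_ext _ (fun _ => C1)), Cprod_const.
    - clear; induction k as [|k IH]; simpl; [|rewrite IH]; ring.
    - intros j Hj; field; auto. }
  assert (He : (e * e = C1)%CC) by apply Cprod_neg_one.
  assert (HGk : G k k = (Cnat (fact k) * Cprod (fun m => Cnat (k + S m)) k)%CC)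
    by (rewrite <- Cprod_rising_fact; apply Shapovalov_V_diag; [assumption|lia]).
  assert (Hplus : poch (xi1 + C1)%CC k = Cprod (fun m => xi1 + Cnat (S m))%CC k)
    by (apply Cprod_ext; intros; rewrite Cnat_S; ring).
  assert (Hk : poch (Cnat k + C1)%CC k = Cprod (fun m => Cnat (k + S m)) k)
    by (apply Cprod_ext; intros; rewrite Cnat_add, Cnat_S; ring).
  rewrite Hplus, Hk in Hp.
  set (A := Cprod (fun m => xi1 + Cnat (S m))%CC k) in *.
  set (D := Cprod (fun m => xi1 - Cnat (S m))%CC k) in *.
  set (K := Cprod (fun m => Cnat (k + S m)) k) in *.
  assert (HD : D <> C0)
    by (apply Cprod_neq_0; intros m Hm; apply Csub_neq_0, Hxi; lia).
  assert (HK : K <> C0)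
    by (apply Cprod_neq_0; intros m Hm; rewrite Nat.add_succ_r; apply Cnat_S_neq_0).
  assert (HcA : (e * A = c * K)%CC).
  { rewrite <- Hp; transitivity (e * (e * (c * T)) * A)%CC; [rewrite HcT; ring|].
    transitivity ((e * e) * (c * (T * A)))%CC; [ring|rewrite He; ring]. }
  (* Squaring removes the sign; only the square of [c] enters the pairing. *)
  assert (HcA2 : (A * A = c * c * (K * K))%CC).
  { transitivity ((e * e) * (A * A))%CC; [rewrite He; ring|].
    transitivity ((e * A) * (e * A))%CC; [ring|rewrite HcA; ring]. }
  assert (HP0 : peval (S k) q C0 = C1).
  { rewrite peval_first; unfold q, psi_coef at 1; simpl; ring. }
  unfold pairing_is; cbv zeta; apply is_CCRInt_cint.
  set (P := peval (S k) q) in *.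
  (* The claimed value is put in the shape of the mean value property at n = 0, where the factor
     [C1] is the zeroth power of z. *)
  replace (Cdiv _ _) with (c * c * G k k * (C1 * (P C0 * P (- C1 - C0))))%CC.
  - apply is_CCRInt_ext with
      (fun s => c * c * G k k *
        (C1 * (P (zline delta s) * P (- C1 - zline delta s))))%CC.
    + intros s; rewrite Hu; symmetry.
      change (mkC s (- delta)) with (lower_line delta s).
      rewrite psi_pairing_integrand; [unfold P, q; ring|assumption| |assumption].
      intros j l Hj Hl; apply HSinv; assumption.
    + apply is_CCRInt_scale; apply (mean_value_peval delta (S k) q Hdelta 0%nat).
  - rewrite HP0, HGk; replace (- C1 - C0)%CC with (- C1)%CC by ring.
    apply (Cmul_cancel_l (D * K)%CC); [apply Cmul_neq_0; assumption|].
    transitivity (A ^ 3 * Cnat (fact k))%CC; [|field; split; assumption].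
    transitivity (c * c * (K * K) * Cnat (fact k) * (P (- C1) * D))%CC; [ring|].
    rewrite HP, <- HcA2; simpl; ring.
Qed.
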